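(* Let $\gamma>0$ and let $\Lambda_1\subseteq\Lambda_2\subseteq\dots$ be any exhaustion of $\mathbb{Z}^d$ by finite sets. Then the weak limit $$\lim_{n\to\infty} m^{(\gamma)}_{\Lambda_n} =: m^{(\gamma)}$$ exists (each $m^{(\gamma)}_{\Lambda_n}$ being regarded as a probability measure on $\Omega^{(\gamma)}$ by extending configurations by $0$ outside $\Lambda_n$), and $m^{(\gamma)}(\mathcal{R}^{(\gamma)})=1$.
   Context: Fix the dimension $d\ge 1$; $x\sim y$ in $\mathbb{Z}^d$ means Euclidean distance $|x-y|=1$. For real $\gamma\ge 0$ let $\Omega^{(\gamma)}=[0,2d+\gamma)^{\mathbb{Z}^d}$ and, for $\Lambda\subseteq\mathbb{Z}^d$ finite, $\Omega^{(\gamma)}_\Lambda=[0,2d+\gamma)^{\Lambda}$ (the $\gamma$-stable height configurations), with the product topology. A configuration $\eta\in\Omega^{(\gamma)}_\Lambda$ (resp. $\eta\in\Omega^{(\gamma)}$) is allowed if there is no nonempty finite $W\subseteq\Lambda$ (resp. $W\subseteq\mathbb{Z}^d$) such that $\eta_y<|\{z\in W: z\sim y\}|$ for every $y\in W$. Let $\mathcal{R}^{(\gamma)}_\Lambda$ be the set of allowed configurations in $\Omega^{(\gamma)}_\Lambda$ and $\mathcal{R}^{(\gamma)}$ the set of allowed configurations in $\Omega^{(\gamma)}$ (equivalently, those $\eta$ with $\eta|_V\in\mathcal{R}^{(\gamma)}_V$ for all finite $V\subseteq \mathbb{Z}^d$). $m^{(\gamma)}_\Lambda$ is the normalized Lebesgue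 measure on $\mathcal{R}^{(\gamma)}_\Lambda$: $m^{(\gamma)}_\Lambda(A)=\mathrm{Vol}(A)/\mathrm{Vol}(\mathcal{R}^{(\gamma)}_\Lambda)$. It is regarded as a measure on $\Omega^{(\gamma)}$ through the inclusion $i:\Omega^{(\gamma)}_\Lambda\to\Omega^{(\gamma)}$, $i(\eta)_x=\eta_x$ for $x\in\Lambda$ and $i(\eta)_x=0$ for $x\notin\Lambda$. *)

(* Defs.v *)
From HB Require Import structures.
From mathcomp Require Import all_boot all_order all_algebra finmap.
From mathcomp Require Import all_classical all_reals all_analysis.

Set Implicit Arguments.
Unset Strict Implicit.
Unset Printing Implicit Defensive.

Import Order.TTheory GRing.Theory Num.Theory.
Import numFieldNormedType.Exports.

Local Open Scope classical_set_scope.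
Local Open Scope ring_scope.

Definition site (d : nat) := 'rV[int]_d.

Definition edist (R : realType) (d : nat) (x y : site d) : R :=
  Num.sqrt (\sum_(i < d) ((x 0 i)%:~R - (y 0 i)%:~R) ^+ 2).

Definition adj (R : realType) (d : nat) (x y : site d) : bool :=
  edist R x y == 1.

(* [config I R] is R^I with the product topology and its Borel sigma-algebra.
   It is used both with I the whole lattice and with I a finite volume. *)
Definition config (I : Type) (R : realType) := {ptws I -> R}.

Section config_instances.
Context (I : Type) (R : realType).
HB.instance Definition _ := Topological.copy (config I R) {ptws I -> R}.
HB.instance Definition _ := isPointed.Build (config I R) (fun=> 0).
HB.instance Definition _ := @isMeasurable.Build
  (sigma_display (@open (config I R))) (config I R)
  <<s @open (config I R) >>
  (@sigma_algebra0 _ setT _) (@sigma_algebraC _ _)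
  (@sigma_algebra_bigcup _ setT _).
End config_instances.

Definition stable (R : realType) (d : nat) (I : Type) (gamma : R) :
    set (config I R) :=
  [set eta | forall x, 0 <= eta x < (2 * d)%:R + gamma].

Section allowed.
Context (R : realType) (d : nat).
(* [pos] gives the lattice position of an index: it is the identity for
   configurations on Z^d and the inclusion for those on a finite volume. *)
Context (I : choiceType) (pos : I -> site d).

Definition nbrs_in (W : {fset I}) (y : I) : nat :=
  #|` [fset z in W | adj R (pos z) (pos y)]%fset|.

Definition forbidden (eta : config I R) (W : {fset I}) : Prop :=
  W != fset0 /\ forall y, y \in W -> eta y < (nbrs_in W y)%:R.

Definition allowed (gamma : R) : set (config I R) :=
  [set eta | stable d gamma eta /\ ~ exists W, forbidden eta W].

End allowed.

Section lattice_and_volumes.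
Context (R : realType) (d : nat).
Implicit Types (gamma : R) (Lambda : {fset site d}).

Definition Omega gamma : set (config (site d) R) := stable d gamma.

Definition Rec gamma : set (config (site d) R) := allowed id gamma.

Definition Rec_fin Lambda gamma : set (config Lambda R) :=
  allowed (fun x : Lambda => val x) gamma.

Definition extend0 Lambda (eta : config Lambda R) : config (site d) R :=
  fun x => if insub x is Some u then eta u else 0.

End lattice_and_volumes.

Arguments Omega {R} d gamma _.
Arguments Rec {R} d gamma _.
Arguments Rec_fin {R d} Lambda gamma _.
Arguments extend0 {R d} Lambda eta _.

Lemma countable_bigcap_measurable disp (T : measurableType disp) (I : countType)
    (F : I -> set T) :
  (forall i, measurable (F i)) -> measurable (\bigcap_i F i).
Proof.
move=> mF; rewrite -[X in measurable X]setCK setC_bigcap.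
apply: measurableC; apply: countable_bigcupT_measurable => //.
by move=> i; exact: measurableC.
Qed.

Section borel_config.
Context (R : realType).

Lemma config_eval_continuous (I : Type) (x : I) :
  continuous (fun eta : config I R => eta x).
Proof. exact: (@proj_continuous {classic I} (fun=> R) x). Qed.

Lemma open_config_measurable (I : Type) (U : set (config I R)) :
  open U -> measurable U.
Proof. exact: sub_sigma_algebra. Qed.

Lemma continuous_config_cvg (T : topologicalType) (I : Type)
    (f : T -> config I R) :
  (forall x, continuous (fun t => f t x)) -> continuous f.
Proof.
move=> cf t; apply/cvg_sup => x.
apply/cvg_image.
  by rewrite eqEsubset; split=> v // _; exists (fun=> v).
move=> A /cf; rewrite /nbhs/= => H.
exists ((fun eta : config I R => eta x) @^-1` A) => //=.
by rewrite image_preimage// eqEsubset; split=> v // _; exists (fun=> v).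
Qed.

Lemma continuous_config_measurable (I J : Type) (f : config I R -> config J R) :
  continuous f -> measurable_fun setT f.
Proof.
move=> cf; apply: (measurability (@open (config J R))) => //.
move=> _ [B oB <-]; rewrite setTI; apply: open_config_measurable.
by apply: open_comp => // *; exact: cf.
Qed.

Lemma config_lt_measurable (I : Type) (x : I) (a : R) :
  measurable [set eta : config I R | eta x < a].
Proof.
apply: open_config_measurable.
have -> : [set eta : config I R | eta x < a] =
  (fun eta : config I R => eta x) @^-1` [set y | y < a] by [].
by apply: open_comp => [? _|]; [exact: config_eval_continuous|exact: open_lt].
Qed.

Lemma allowed_measurable d (I : countType) (pos : I -> site d) (gamma : R) :
  measurable (allowed pos gamma).
Proof.
have mlt (x : I) (a : R) : measurable [set eta : config I R | eta x < a].
  exact: config_lt_measurable.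
have -> : allowed pos gamma =
    (\bigcap_x ([set eta : config I R | eta x < (2 * d)%:R + gamma] `\`
                [set eta | eta x < 0])) `\`
    \bigcup_(W in [set W : {fset I} | W != fset0])
      \bigcap_(y in [set` W]) [set eta | eta y < (nbrs_in R pos W y)%:R].
  apply/seteqP; split=> eta /=.
    move=> [st al]; split.
      move=> x _ /=; have /andP[? ->] := st x; split=> //.
      by apply/negP; rewrite -leNgt.
    by move=> [W W0 H]; apply: al; exists W; split => // y yW; exact: H.
  move=> [st al]; split.
    move=> x; have /= [-> /negP] := st x Logic.I.
    by rewrite -leNgt => ->.
  by move=> [W [W0 H]]; apply: al; exists W => // y yW; exact: H.
apply: measurableD; first by apply: countable_bigcap_measurable => x; exact: measurableD.
rewrite bigcup_mkcond; apply: countable_bigcupT_measurable => // W.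
case: ifPn => // _; rewrite bigcap_mkcond; apply: countable_bigcap_measurable => y.
by case: ifPn.
Qed.

End borel_config.

Lemma adj_unit_vector (R : realType) d (x y : site d) : adj R x y ->
  exists p : 'I_d * bool, x = y + (-1) ^+ p.2 *: delta_mx 0 p.1.
Proof.
move=> /eqP xy.
have sqr1 : \sum_(i < d) (x 0 i - y 0 i) ^+ 2 = 1.
  apply/eqP; rewrite -(eqr_int R) rmorph_sum/=.
  rewrite (eq_bigr (fun i => ((x 0 i)%:~R - (y 0 i)%:~R) ^+ 2 : R)); last first.
    by move=> i _; rewrite rmorphXn/= rmorphB.
  have S0 : 0 <= \sum_(i < d) ((x 0 i)%:~R - (y 0 i)%:~R : R) ^+ 2.
    by apply: sumr_ge0 => i _; exact: sqr_ge0.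
  by rewrite -(sqr_sqrtr S0) [Num.sqrt _]xy expr1n.
have [i xyi] : exists i, x 0 i != y 0 i.
  apply/existsP; apply: contraPT sqr1 => /existsPn xy0.
  rewrite big1// => i _.
  by have := xy0 i; rewrite negbK => /eqP ->; rewrite subrr expr0n.
have z0 : x 0 i - y 0 i != 0 by rewrite subr_eq0.
have ge1 : 1 <= (x 0 i - y 0 i) ^+ 2.
  by rewrite -gtz0_ge1 exprn_even_gt0.
have rest_ge0 : 0 <= \sum_(j < d | j != i) (x 0 j - y 0 j) ^+ 2.
  by apply: sumr_ge0 => ? _; exact: sqr_ge0.
move: sqr1; rewrite (bigD1 i)//= => sqr1.
have rest0 : \sum_(j < d | j != i) (x 0 j - y 0 j) ^+ 2 = 0.
  by apply: le_anti; rewrite rest_ge0 andbT -(lerD2l ((x 0 i - y 0 i) ^+ 2)) sqr1 addr0.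
have zi : (x 0 i - y 0 i) ^+ 2 = 1 by rewrite -sqr1 rest0 addr0.
have xyE j : j != i -> x 0 j = y 0 j.
  move=> ji; apply/eqP; rewrite -subr_eq0 -sqrf_eq0.
  by apply/eqP; apply: (psumr_eq0P _ rest0) => // ? _; exact: sqr_ge0.
have [s xiE] : exists s : bool, x 0 i - y 0 i = (-1) ^+ s.
  move/eqP: zi; rewrite sqrf_eq1 => /orP[]/eqP ->; first by exists false.
  by exists true.
exists (i, s); apply/rowP => j; rewrite !mxE /=.
have [->|ji] := eqVneq j i; first by rewrite mulr1 -xiE addrC subrK.
by rewrite mulr0 addr0 xyE.
Qed.

Lemma nbrs_in_le (R : realType) d (I : choiceType) (pos : I -> site d)
    (W : {fset I}) (y : I) :
  injective pos -> (nbrs_in R pos W y <= 2 * d)%N.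
Proof.
move=> pos_inj; rewrite /nbrs_in; set N := [fset z in W | _]%fset.
pose f (p : 'I_d * bool) := pos y + (-1) ^+ p.2 *: delta_mx 0 p.1.
have sub : {subset [seq pos z | z <- N] <= [seq f p | p : 'I_d * bool]}.
  move=> _ /mapP[z zN ->]; move: zN; rewrite !inE => /andP[_].
  by move=> /adj_unit_vector[p ->]; apply/mapP; exists p => //; rewrite mem_enum.
have /uniq_leq_size/(_ sub) : uniq [seq pos z | z <- N].
  by rewrite map_inj_uniq.
by rewrite size_map size_image card_prod card_ord card_bool mulnC.
Qed.

(* n-fold product of the one-dimensional Lebesgue measure. *)
Fixpoint lebesgue_tuple (R : realType) (n : nat) :
    set (n.-tuple (measurableTypeR R)) -> \bar R :=
  match n with
  | 0 => dirac [tuple]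
  | m.+1 => pushforward (lebesgue_measure \x (@lebesgue_tuple R m))%E
              (fun p => [tuple of p.1 :: p.2])
  end.

Arguments lebesgue_tuple R n A : clear implicits.

Section product_sigma_finite.
Context d1 d2 (T1 : measurableType d1) (T2 : measurableType d2) (R : realType).
Variable m1 : {sigma_finite_measure set T1 -> \bar R}.
Variable m2 : {sigma_finite_measure set T2 -> \bar R}.

(* The library's own instance for [m1 \x m2] is only found when m1 and m2 are
   subprobabilities. *)
Lemma product_sigma_finite : sigma_finite setT (m1 \x m2)%E.
Proof.
have /sigma_finiteP[F [TF ndF Foo]] := sigma_finiteT m1.
have /sigma_finiteP[G [TG ndG Goo]] := sigma_finiteT m2.
exists (fun n => F n `*` G n).
  rewrite -setXTT TF TG predeqE => -[x y]; split.
    move=> [/= [n _ Fnx] [k _ Gky]]; exists (maxn n k) => //; split.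
    - by move: x Fnx; exact/subsetPset/ndF/leq_maxl.
    - by move: y Gky; exact/subsetPset/ndG/leq_maxr.
  by move=> [n _ []/= ? ?]; split; exists n.
move=> k; have [? ?] := Foo k; have [? ?] := Goo k.
split; first exact: measurableX.
by rewrite product_measure1E// lte_mul_pinfty// ge0_fin_numE.
Qed.

End product_sigma_finite.

Lemma exists_sigma_finite_measure d (T : measurableType d) (R : realType)
    (nu : set T -> \bar R) :
  nu set0 = 0%E -> (forall A, (0 <= nu A)%E) -> semi_sigma_additive nu ->
  sigma_finite setT nu ->
  exists mu : {sigma_finite_measure set T -> \bar R}, nu = mu.
Proof.
move=> nu0 nu_ge0 nu_sigma nu_fin.
pose M1 := isMeasure.Build _ _ _ nu nu0 nu_ge0 nu_sigma.
pose mu : {measure set T -> \bar R} := HB.pack nu M1.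
pose M2 := Measure_isSigmaFinite.Build _ _ _ mu nu_fin.
pose mu' : sigma_finite_measure _ _ := HB.pack (Measure.sort mu) M2.
by exists mu'.
Qed.

Section lebesgue_tuple_measure.
Context (R : realType).
Notation Rn := (fun n => n.-tuple (measurableTypeR R)).

Lemma measurable_cons_tuple n : measurable_fun setT
  (fun p : measurableTypeR R * Rn n => [tuple of p.1 :: p.2]).
Proof. exact: measurable_cons. Qed.

Lemma lebesgue_tuple_is_measure n :
  exists mu : {sigma_finite_measure set (Rn n) -> \bar R},
    lebesgue_tuple R n = mu :> (set _ -> \bar R).
Proof.
elim: n => [|n [mu IH]]/=.
  by exists (@dirac _ (0.-tuple (measurableTypeR R)) [tuple] R).
rewrite IH.
pose nu := pushforward (lebesgue_measure \x mu)%E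
  (fun p : measurableTypeR R * Rn n => [tuple of p.1 :: p.2]).
have nu0 : nu set0 = 0%E by rewrite /nu /pushforward preimage_set0 measure0.
have nu_ge0 A : (0 <= nu A)%E by rewrite /nu/pushforward; exact: measure_ge0.
have nu_sigma : semi_sigma_additive nu.
  pose m := measure_function_pushforward__canonical__measure_function_Measure
    (lebesgue_measure \x mu)%E (@measurable_cons_tuple n).
  exact: (@measure_semi_sigma_additive _ _ _ m).
have nu_fin : sigma_finite setT nu.
  have [F FT F_fin] := product_sigma_finite (@lebesgue_measure R) mu.
  exists (fun k => [set t : Rn n.+1 | F k (thead t, [tuple of behead t])]).
    apply/esym; rewrite -subTset => t _.
    have : setT (thead t, [tuple of behead t]) by [].
    by rewrite FT => -[k _ Fk]; exists k.
  move=> k; have [mF fF] := F_fin k; split.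
    pose h (t : Rn n.+1) : measurableTypeR R * Rn n :=
      (thead t, [tuple of behead t]).
    have mh : measurable_fun setT h.
      by apply: measurable_fun_pair; [exact: measurable_tnth|exact: measurable_behead].
    by rewrite -[X in measurable X]setTI; exact: mh.
  rewrite /nu /pushforward/=.
  suff -> : (fun p : measurableTypeR R * Rn n => [tuple of p.1 :: p.2]) @^-1`
    [set t : Rn n.+1 | F k (thead t, [tuple of behead t])] = F k by [].
  apply/seteqP; split=> -[a b] /=; rewrite theadE; congr (F k (_, _)).
    by apply/val_inj.
  by apply/val_inj.
have [M nuE] := exists_sigma_finite_measure nu0 nu_ge0 nu_sigma nu_fin.
by exists M; rewrite -nuE.
Qed.

Let mu_n n : {sigma_finite_measure set (Rn n) -> \bar R} :=
  projT1 (cid (lebesgue_tuple_is_measure n)).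

Let mu_nE n : lebesgue_tuple R n = mu_n n :> (set _ -> \bar R) :=
  projT2 (cid (lebesgue_tuple_is_measure n)).

Let lebesgue_tuple0 n : lebesgue_tuple R n set0 = 0%E.
Proof. by rewrite mu_nE measure0. Qed.

Let lebesgue_tuple_ge0 n A : (0 <= lebesgue_tuple R n A)%E.
Proof. by rewrite mu_nE measure_ge0. Qed.

Let lebesgue_tuple_sigma_additive n :
  semi_sigma_additive (lebesgue_tuple R n).
Proof. by rewrite mu_nE; exact: measure_semi_sigma_additive. Qed.

Let lebesgue_tuple_sigma_finite n : sigma_finite setT (lebesgue_tuple R n).
Proof. by rewrite mu_nE; exact: sigma_finiteT. Qed.

HB.instance Definition _ n := isMeasure.Build _ _ _ (lebesgue_tuple R n)
  (lebesgue_tuple0 n) (@lebesgue_tuple_ge0 n)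
  (@lebesgue_tuple_sigma_additive n).

HB.instance Definition _ n := Measure_isSigmaFinite.Build _ _ _
  (lebesgue_tuple R n) (lebesgue_tuple_sigma_finite n).

End lebesgue_tuple_measure.

Lemma tuple_box_measurable (R : realType) n (a b : R) :
  measurable [set t : n.-tuple (measurableTypeR R) |
    forall i, a <= (tnth t i : R) < b].
Proof.
have -> : [set t : n.-tuple (measurableTypeR R) |
    forall i, a <= (tnth t i : R) < b] =
  \bigcap_i ((@tnth _ _ ^~ i) @^-1`
     (`[a, b[%classic : set (measurableTypeR R))).
  by apply/seteqP; split=> t /= h i; [move=> _|]; have := h i;
    rewrite /= in_itv/= //; apply.
apply: countable_bigcap_measurable => i.
by rewrite -[X in measurable X]setTI; exact: measurable_tnth.
Qed.

Lemma lebesgue_tuple_box (R : realType) n (a b : R) : a <= b ->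
  lebesgue_tuple R n [set t | forall i, a <= (tnth t i : R) < b] =
  ((b - a) ^+ n)%:E.
Proof.
move=> ab; elim: n => [|n IH].
  rewrite /= diracE mem_set//=; by case.
rewrite /= /pushforward.
have -> : (fun p : measurableTypeR R * n.-tuple (measurableTypeR R) =>
    [tuple of p.1 :: p.2]) @^-1`
      [set t | forall i, a <= (tnth t i : R) < b] =
   (`[a, b[%classic : set (measurableTypeR R)) `*`
     [set t : n.-tuple (measurableTypeR R) | forall i, a <= (tnth t i : R) < b].
  apply/seteqP; split=> -[x t] /=.
    move=> h; split; first by have := h ord0; rewrite /= in_itv.
    by move=> i; have := h (lift ord0 i); rewrite tnthS.
  move=> [+ h] i; rewrite in_itv/=; have [j ->|->//] := unliftP ord0 i.
  by move=> _; rewrite tnthS.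
rewrite product_measure1E//; last exact: tuple_box_measurable.
have lebE : lebesgue_measure (`[a, b[%classic : set R) = (b - a)%:E.
  rewrite lebesgue_measure_itv/= lte_fin; case: ifPn => [_|]//.
  rewrite -leNgt => ba; have -> : b = a by apply/le_anti; rewrite ab ba.
  by rewrite subrr.
by rewrite exprS EFinM; congr (_ * _)%E; [exact: lebE|exact: IH].
Qed.

Section lebesgue_config.
Context (R : realType) (I : finType).

(* Lebesgue measure on R^n does not depend on the order of the coordinates, so
   the enumeration of I used here is immaterial. *)
Definition config_of_tuple (t : #|I|.-tuple (measurableTypeR R)) : config I R :=
  fun x => tnth t (enum_rank x).

Lemma config_of_tuple_measurable : measurable_fun setT config_of_tuple.
Proof.
apply: (measurability (@open (config I R))) => //.
move=> _ [U oU <-]; rewrite setTI.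
pose B (q : {ffun 'I_#|I| -> rat * rat}) := [set t : #|I|.-tuple (measurableTypeR R) |
  forall i, ratr (q i).1 < (tnth t i : R) < ratr (q i).2].
have mB q : measurable (B q).
  have -> : B q = \bigcap_i ((@tnth _ _ ^~ i) @^-1`
       (`](ratr (q i).1), (ratr (q i).2)[%classic : set (measurableTypeR R))).
    by apply/seteqP; split=> t /= h i; [move=> _|]; have := h i; rewrite /= in_itv/= //; apply.
  apply: countable_bigcap_measurable => i.
  by rewrite -[X in measurable X]setTI; exact: measurable_tnth.
have -> : config_of_tuple @^-1` U =
    \bigcup_(q in [set q | B q `<=` config_of_tuple @^-1` U]) B q.
  apply/seteqP; split; last by move=> t [q] /= qU /qU.
  move=> t Ut.
  pose g (v : 'rV[R]_#|I|) : config I R := fun x => v 0 (enum_rank x).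
  have cg : continuous g.
    by apply: continuous_config_cvg => x; exact: coord_continuous.
  pose v : 'rV[R]_#|I| := \row_i tnth t i.
  have /nbhs_ballP[e /= e0 He] : nbhs v (g @^-1` U).
    apply: cg; apply: open_nbhs_nbhs; split=> //.
    suff -> : g v = config_of_tuple t by [].
    by apply/funext => x; rewrite /g mxE.
  have /= H i : exists q : rat * rat, (tnth t i - e < ratr q.1 < tnth t i) && ((tnth t i : R) < ratr q.2 < tnth t i + e).
    have /rat_in_itvoo[q1] : (tnth t i : R) - e < tnth t i by rewrite ltrBlDr ltrDl.
    have /rat_in_itvoo[q2] : (tnth t i : R) < tnth t i + e by rewrite ltrDl.
    by rewrite !in_itv/= => h2 h1; exists (q1, q2); rewrite h1 h2.
  pose q := [ffun i => projT1 (cid (H i))].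
  have Hq i : (tnth t i - e < ratr (q i).1 < tnth t i) && ((tnth t i : R) < ratr (q i).2 < tnth t i + e).
    by rewrite /q ffunE; exact: projT2 (cid (H i)).
  exists q; last by move=> i; have /andP[/andP[_ ->] /andP[]] := Hq i.
  move=> s Bs /=.
  have -> : config_of_tuple s = g (\row_i tnth s i).
    by rewrite /g; apply/funext => x; rewrite mxE.
  apply: He; split=> // i j; rewrite !mxE /ball/=.
  have /andP[/andP[a1 _] /andP[_ a2]] := Hq j.
  have /andP[b1 b2] := Bs j.
  by rewrite distrC ltr_distl (lt_trans a1 b1) (lt_trans b2 a2).
rewrite bigcup_mkcond; apply: countable_bigcupT_measurable => // q.
by case: ifPn.
Qed.

End lebesgue_config.

Section volume.
Context (R : realType) (I : finType).

Definition vol : set (config I R) -> \bar R :=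
  pushforward (lebesgue_tuple R #|I|) (@config_of_tuple R I).

Let vol0 : vol set0 = 0%E.
Proof. by rewrite /vol /pushforward preimage_set0 measure0. Qed.

Let vol_ge0 A : (0 <= vol A)%E.
Proof. by rewrite /vol /pushforward measure_ge0. Qed.

Let vol_sigma_additive : semi_sigma_additive vol.
Proof.
pose m := measure_function_pushforward__canonical__measure_function_Measure
  (lebesgue_tuple R #|I|) (@config_of_tuple_measurable R I).
exact: (@measure_semi_sigma_additive _ _ _ m).
Qed.

HB.instance Definition _ := isMeasure.Build _ _ _ vol
  vol0 vol_ge0 vol_sigma_additive.

End volume.

Section normalized_volume.
Context (R : realType) (d : nat) (gamma : R).

Lemma Rec_fin_measurable (Lambda : {fset site d}) :
  measurable (Rec_fin Lambda gamma).
Proof. exact: allowed_measurable. Qed.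

(* [mnormalize] needs a default probability in case the total mass is 0 or
   infinite; this never happens when [gamma > 0], see [m_finE] below. *)
Definition m_fin (Lambda : {fset site d}) : set (config Lambda R) -> \bar R :=
  mnormalize (mrestr (@vol R Lambda) (@Rec_fin_measurable Lambda)) \d_point.

Arguments m_fin : clear implicits.

HB.instance Definition _ (Lambda : {fset site d}) :=
  Probability.on (m_fin Lambda).

Lemma extend0_measurable (Lambda : {fset site d}) :
  measurable_fun setT (extend0 (R := R) Lambda).
Proof.
apply: continuous_config_measurable; apply: continuous_config_cvg => x.
rewrite /extend0; case: insubP => [u _ _|_].
  exact: config_eval_continuous.
exact: cst_continuous.
Qed.

Definition m_ext (Lambda : {fset site d}) :
    set (config (site d) R) -> \bar R :=
  pushforward (m_fin Lambda) (@extend0 R d Lambda).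

Arguments m_ext : clear implicits.

Let m_ext0 Lambda : m_ext Lambda set0 = 0%E.
Proof. by rewrite /m_ext /pushforward preimage_set0 measure0. Qed.

Let m_ext_ge0 Lambda A : (0 <= m_ext Lambda A)%E.
Proof. by rewrite /m_ext /pushforward measure_ge0. Qed.

Let m_ext_sigma_additive Lambda : semi_sigma_additive (m_ext Lambda).
Proof.
pose m := measure_function_pushforward__canonical__measure_function_Measure
  (m_fin Lambda) (extend0_measurable (Lambda := Lambda)).
exact: (@measure_semi_sigma_additive _ _ _ m).
Qed.

HB.instance Definition _ Lambda := isMeasure.Build _ _ _ (m_ext Lambda)
  (m_ext0 Lambda) (@m_ext_ge0 Lambda) (@m_ext_sigma_additive Lambda).

Let m_extT Lambda : m_ext Lambda setT = 1%E.
Proof. by rewrite /m_ext /pushforward preimage_setT probability_setT. Qed.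

HB.instance Definition _ Lambda :=
  Measure_isProbability.Build _ _ _ (m_ext Lambda) (m_extT Lambda).

End normalized_volume.

Arguments m_fin {R d} gamma Lambda _.
Arguments m_ext {R d} gamma Lambda _.

Lemma vol_box (R : realType) (I : finType) (a b : R) : a <= b ->
  vol [set eta : config I R | forall x, a <= eta x < b] =
  ((b - a) ^+ #|I|)%:E.
Proof.
move=> ab; rewrite -lebesgue_tuple_box// /vol /pushforward.
congr (lebesgue_tuple _ _ _); apply/seteqP; split=> t /= h i.
  by have := h (enum_val i); rewrite /config_of_tuple enum_valK.
exact: h.
Qed.

Lemma box_measurable (R : realType) (I : countType) (a b : R) :
  measurable [set eta : config I R | forall x, a <= eta x < b].
Proof.
have -> : [set eta : config I R | forall x, a <= eta x < b] =
    \bigcap_x ([set eta : config I R | eta x < b] `\` [set eta | eta x < a]).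
  apply/seteqP; split=> eta h x.
    by move=> _; have /andP[ax xb] := h x; split=> //=; apply/negP; rewrite -leNgt.
  by have [/= -> /negP] := h x Logic.I; rewrite -leNgt => ->.
apply: countable_bigcap_measurable => x.
by apply: measurableD; exact: config_lt_measurable.
Qed.

Lemma vol_Rec_fin_gt0 (R : realType) d (gamma : R) (Lambda : {fset site d}) :
  0 < gamma -> (0 < vol (Rec_fin Lambda gamma))%E.
Proof.
move=> g0; pose b := (2 * d)%:R + gamma.
apply: (@lt_le_trans _ _
  (vol [set eta : config Lambda R | forall x, (2 * d)%:R <= eta x < b])).
  rewrite vol_box; last by rewrite lerDl ltW.
  by rewrite lte_fin exprn_gt0// /b addrAC subrr add0r.
apply: le_measure; rewrite ?inE; [exact: box_measurable|
  exact: allowed_measurable|].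
move=> eta h; split.
  by move=> x; have /andP[dx ->] := h x; rewrite (le_trans _ dx).
move=> [W [W0 forb]].
have [y yW] : exists y, y \in W by apply/fset0Pn.
have := forb _ yW; rewrite ltNge => /negP; apply.
have /andP[+ _] := h y; apply: le_trans.
by rewrite ler_nat nbrs_in_le//; exact: val_inj.
Qed.

Lemma vol_Rec_fin_lty (R : realType) d (gamma : R) (Lambda : {fset site d}) :
  0 <= gamma -> (vol (Rec_fin Lambda gamma) < +oo)%E.
Proof.
move=> g0; pose b := (2 * d)%:R + gamma.
apply: (@le_lt_trans _ _
  (vol [set eta : config Lambda R | forall x, 0 <= eta x < b])).
  apply: le_measure; rewrite ?inE; [exact: allowed_measurable|
    exact: box_measurable|by move=> eta []].
by rewrite vol_box ?ltry// addr_ge0.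
Qed.

Lemma m_finE (R : realType) d (gamma : R) (Lambda : {fset site d})
    (A : set (config Lambda R)) : 0 < gamma ->
  m_fin gamma Lambda A =
  (vol (A `&` Rec_fin Lambda gamma) *
    (fine (vol (Rec_fin Lambda gamma)))^-1%:E)%E.
Proof.
move=> g0; have volE : mrestr (@vol R Lambda)
    (@Rec_fin_measurable R d gamma Lambda) setT = vol (Rec_fin Lambda gamma).
  by rewrite /mrestr setTI.
rewrite /m_fin /mnormalize; case: ifPn => [/orP[]|_].
- by move=> /eqP /(etrans (esym volE)) v0; have := vol_Rec_fin_gt0 Lambda g0; rewrite v0 ltxx.
- by move=> /eqP /(etrans (esym volE)) v0; have := vol_Rec_fin_lty Lambda (ltW g0); rewrite v0 ltxx.
- by congr (_ * (fine _)^-1%:E)%E; exact: volE.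
Qed.

(* Weak convergence of probability measures on the subspace D of R^I, when
   measures on D are represented by measures on R^I carried by D: the test
   functions are the bounded functions on D that are continuous for the
   subspace topology; their values off D play no role. *)
Definition weak_cvg_on (R : realType) (I : Type) (D : set (config I R))
    (mu_ : nat -> probability (config I R) R)
    (mu : probability (config I R) R) : Prop :=
  forall f : config I R -> R,
    {within D, continuous f} -> [bounded f eta | eta in D] ->
    (fun n => \int[mu_ n]_(eta in D) (f eta)%:E)%E @ \oo -->
    (\int[mu]_(eta in D) (f eta)%:E)%E.

Definition exhaustion (T : choiceType) (Lambda : nat -> {fset T}) : Prop :=
  (forall n, (Lambda n `<=` Lambda n.+1)%fset) /\
  (forall x, exists n, x \in Lambda n).

(* Main.v *)
Require Import Defs.
From HB Require Import structures.
From mathcomp Require Import all_boot all_order all_algebra finmap.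
From mathcomp Require Import all_classical all_reals all_analysis.
From mathcomp.analysis.showcase Require Import summability.
From mathcomp Require Import ring lra.

Set Implicit Arguments.
Unset Strict Implicit.
Unset Printing Implicit Defensive.

Import Order.TTheory GRing.Theory Num.Theory.
Import numFieldNormedType.Exports.

Local Open Scope classical_set_scope.
Local Open Scope ring_scope.

(** Why the limit exists. Burn a configuration as in the sandpile burning
    algorithm: a site y catches fire as soon as its height is at least the
    number of its unburnt neighbours. A configuration on a finite volume L is
    allowed exactly when all of L burns. A site of height at least 2d burns
    unconditionally, and since gamma > 0 such heights have positive probability:
    burning starts inside L and does not need its boundary.

    Call a finite set W self-burning when W burns although every site outside
    W is kept unburnt. On that event, which depends on the heights in W only,
    an ambient configuration on L is allowed if and only if its restriction to
    L minus W is. Hence a function F of the heights in W that vanishes unless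
    W is self-burning has mean (integral of F) * Z(L minus W) / Z(L) under
    m_L, where Z is the volume of the allowed configurations
    (selfburn_cvg). These ratios of volumes converge as L grows, because
    they are products of one-site ratios Z(L minus x) / Z(L), each
    monotone in L and at most 1 / gamma (ratio_mono, ratio_le).

    Both the monotonicity of the ratios and the fact that a given site lies in a
    small self-burning set with probability close to 1 come from one recursion (stuck_prob_rec), obtained
    by integrating out the height of a single site. It shows
    (stuck_prob_harmonic) that the probability u that x stays unburnt
    when a set K disjoint from L is kept unburnt solves
    (2d + gamma) u(y) = #(neighbours of y in K) + sum of u over the
    neighbours of y in L, that is, u is the probability that a random
    walk with killing reaches K. The maximum principle gives monotonicity, and
    killing gives exponential decay in the distance to K
    (stuck_prob_decay). This replaces the usual detour through spanning
    forests and determinants.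

    A bounded function of finitely many heights is then, up to an error that
    is uniform in L, supported on the event that these heights lie in some
    self-burning subset of a large ball. Since a union of self-burning sets is
    self-burning, inclusion and exclusion over the subsets of the ball gives
    the convergence of its mean along all finite volumes (local_cvg).

    To pass to measures, a configuration is coded by the countably many bits
    (rational t <= height at x). The masses of the cylinders of this coding
    converge. Splitting [0, 1) into nested intervals with these limiting masses
    as lengths turns a uniform random number into a random configuration,
    whose law is the limit measure (decode_law, bit_decode_ae,
    limit_measure_cyl); the point to check is that a decoded height
    almost never equals a rational level that its bits did not reach, which
    holds because a height falls in [s, t) with probability at most
    (t - s) / gamma. A long initial segment of its code confines a
    configuration to a small neighbourhood, so a bounded continuous function is
    squeezed between step functions of the code, and weak convergence follows
    (weak_limit). Finally, each forbidden
    subconfiguration is a cylinder event that has mass 0 in every volume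
    containing it. *)

(** * Burning *)
Section Burning.
Local Open Scope fset_scope.
Local Open Scope ring_scope.
Variables (R : realFieldType) (S : choiceType) (e : rel S).
Implicit Types (U V W K L : {fset S}) (x y z : S) (eta : S -> R).

Definition deg W y : nat := #|` [fset z in W | e z y]|.

Lemma deg_le W W' y :
  (forall z, z \in W -> e z y -> z \in W') -> (deg W y <= deg W' y)%N.
Proof.
move=> sub; apply/fsubset_leq_card/fsubsetP => z; rewrite !inE /= => /andP[zW zy].
by rewrite zy sub.
Qed.

Lemma degE W y : deg W y = (\sum_(z <- W | e z y) 1)%N.
Proof. by rewrite big_fset_condE -card_fset_sum1. Qed.

Lemma degDE W V K y : W `<=` V -> [disjoint V & K] ->
  deg (W `|` K) y = (deg K y + \sum_(z <- V | e z y) (z \in W))%N.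
Proof.
move=> WV VK; have -> : (\sum_(z <- V | e z y) (z \in W) = deg W y)%N.
  transitivity (\sum_(z <- V | e z y && (z \in W)) 1)%N.
    by rewrite [RHS]big_mkcondr/=; apply: eq_bigr => z _; case: (z \in W).
  rewrite big_fset_condE -card_fset_sum1; congr #|` _|.
  apply/fsetP => z; rewrite !inE /=; have [zW|_] := boolP (z \in W).
    by rewrite (fsubsetP WV) ?andbT.
  by rewrite !andbF.
rewrite /deg addnC -cardfsUI.
suff -> : ([fset z in W | e z y] `&` [fset z in K | e z y])%fset = fset0.
  rewrite cardfs0 addn0; congr #|` _|.
  by apply/fsetP => z; rewrite !inE /= -andb_orl.
apply/fsetP => z; rewrite !inE /=; apply/negP => /andP[/andP[zW _] /andP[zK _]].
by move/fdisjointP: VK => /(_ z (fsubsetP WV _ zW)); rewrite zK.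
Qed.

(** No site of U can be the first one to burn, when U and K are unburnt. *)
Definition stuck K eta U := all (fun y => eta y < (deg (U `|` K) y)%:R) U.

(** The part of V that never burns when K is kept unburnt for ever. Stuck sets
    are closed under union, so it is the largest stuck subset of V. *)
Definition core V K eta : {fset S} :=
  \bigcup_(U <- fpowerset V | stuck K eta U) U.

Lemma core_max V K eta U : U `<=` V -> stuck K eta U -> U `<=` core V K eta.
Proof. by move=> UV sU; apply: (@bigfcup_sup _ _ _ U); rewrite ?fpowersetE. Qed.

Lemma core_sub V K eta : core V K eta `<=` V.
Proof. by apply/bigfcupsP => U; rewrite fpowersetE. Qed.

Lemma stuckP K eta U :
  reflect (forall y, y \in U -> eta y < (deg (U `|` K) y)%:R) (stuck K eta U).
Proof. exact: allP. Qed.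

Lemma ltr_deg W W' y (v : R) : v < (deg W y)%:R ->
  (forall z, z \in W -> e z y -> z \in W') -> v < (deg W' y)%:R.
Proof. by move=> vW /deg_le WW'; rewrite (lt_le_trans vW)// ler_nat. Qed.

Lemma core_stuck V K eta : stuck K eta (core V K eta).
Proof.
apply/stuckP => y /bigfcupP[U /andP[]]; rewrite fpowersetE => UV sU yU.
apply: (ltr_deg (stuckP _ _ _ sU y yU)) => z + _.
by apply/fsubsetP/fsetSU/core_max.
Qed.

Lemma core_lt V K eta y : y \in core V K eta ->
  eta y < (deg (core V K eta `|` K) y)%:R.
Proof. exact: (stuckP _ _ _ (core_stuck V K eta)). Qed.

(** The comparison principle for burning: what stays unburnt in one process,
    cut down to V', is stuck in a second process as soon as all the unburnt
    sites felt by it are unburnt there as well. *)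
Lemma core_cut V K V' K' eta :
  (forall y z, y \in core V K eta -> y \in V' -> z \in core V K eta `|` K ->
     e z y -> z \in (core V K eta `&` V') `|` K') ->
  core V K eta `&` V' `<=` core V' K' eta.
Proof.
move=> h; apply: core_max; first exact: fsubsetIr.
apply/stuckP => y /fsetIP[yU yV']; apply: ltr_deg (core_lt yU) _ => z zU zy.
exact: h zU zy.
Qed.

Lemma core_local V K eta eta' : {in V, eta =1 eta'} ->
  core V K eta = core V K eta'.
Proof.
move=> eq_eta; rewrite /core big_seq_cond [RHS]big_seq_cond.
apply: eq_bigl => U; rewrite fpowersetE; have [UV|//] := boolP (U `<=` V).
by apply: eq_in_all => y /(fsubsetP UV) /eq_eta ->.
Qed.

Hypothesis e_irr : irreflexive e.

Definition burnable L eta := core L fset0 eta == fset0.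

(** The order of burning does not matter, so x may wait until everything else
    that can burn without it has burnt. *)
Lemma core_delay V K eta x : x \in V ->
  (x \in core V K eta) =
  (eta x < (deg (core (V `\ x) (x |` K) eta `|` K) x)%:R).
Proof.
move=> xV; apply/idP/idP => [xU|lt_x].
  apply: ltr_deg (core_lt xU) _ => z /fsetUP[zU|zK] zx; last by rewrite inE zK orbT.
  have zNx : z != x by apply: contraTneq zx => ->; rewrite e_irr.
  rewrite inE (fsubsetP (@core_cut V K (V `\ x) (x |` K) eta _)) //.
    move=> y w _ _; rewrite !inE => /orP[wU|->] _; last by rewrite !orbT.
    rewrite wU (fsubsetP (core_sub _ _ _) _ wU) andbT /=.
    by case: (w == x).
  by rewrite !inE zU zNx (fsubsetP (core_sub _ _ _) _ zU).
set C := core (V `\ x) (x |` K) eta in lt_x *.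
have CV : C `<=` V `\ x by exact: core_sub.
have sub : x |` C `<=` V.
  by rewrite fsubUset fsub1set xV (fsubset_trans CV)// fsubD1set.
apply: (fsubsetP (core_max sub (K := K) (eta := eta) _)); last by rewrite !inE eqxx.
apply/stuckP => y; rewrite !inE => /orP[/eqP->|yC].
  apply: ltr_deg lt_x _ => z; rewrite !inE => /orP[]->; by rewrite ?orbT.
apply: ltr_deg (core_lt yC) _ => z; rewrite !inE.
by move=> /orP[->|/orP[]->]; rewrite ?orbT.
Qed.

Lemma burnableD1 L eta x : x \in L ->
  burnable L eta = burnable (L `\ x) eta &&
    ((deg (core (L `\ x) [fset x] eta) x)%:R <= eta x).
Proof.
move=> xL; rewrite leNgt.
have <- : (x \in core L fset0 eta) =
    (eta x < (deg (core (L `\ x) [fset x] eta) x)%:R).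
  by rewrite core_delay// !fsetU0.
apply/idP/andP => [/eqP bL|[/eqP bLx xNU]].
  rewrite bL inE; split=> //; rewrite /burnable -fsubset0 -[X in _ `<=` X]bL.
  have := @core_cut (L `\ x) fset0 L fset0 eta.
  rewrite (fsetIidPl _); last first.
    by rewrite (fsubset_trans (core_sub _ _ _))// fsubD1set.
  by apply=> y z.
have := @core_cut L fset0 (L `\ x) fset0 eta; rewrite bLx (fsetIidPl _).
  by rewrite fsubset0; apply=> y z _ _ ->.
by rewrite fsubsetD1 core_sub.
Qed.

(** The condition under which sites outside V that are kept unburnt by K
    include all the sites of L that V can feel; burning V against K is then
    harder than burning it inside L. *)
Definition sees V L K := forall y z, y \in V -> z \in L `\` V -> e z y -> z \in K.

(** Delay x until nothing else burns. What burns in V against K and x also burns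
    in L without x, so a height that lets x burn in V lets it burn in L too. The
    event thus decouples into an event of the other heights and a lower bound
    on the height at x. *)
Lemma burn_first V K L eta x : x \in V -> V `<=` L -> sees V L K ->
  (x \notin core V K eta) && burnable L eta =
  burnable (L `\ x) eta &&
    ((deg (core (V `\ x) (x |` K) eta `|` K) x)%:R <= eta x).
Proof.
move=> xV VL bdK; rewrite core_delay// -leNgt (burnableD1 _ (fsubsetP VL _ xV)).
rewrite andbC -andbA; congr andb.
apply/andb_idl => xT; apply: le_trans xT; rewrite ler_nat.
apply: deg_le => z zU zx; rewrite inE.
have [zK|zNK] := boolP (z \in K); first by rewrite orbT.
rewrite orbF; apply: (fsubsetP (@core_cut (L `\ x) [fset x] (V `\ x) (x |` K) eta _)).
  move=> y w _; rewrite !inE => /andP[_ yV] /orP[wU|->//] wy; last by rewrite orbT.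
  have [wK|wNK] := boolP (w \in K); first by rewrite !orbT.
  have := fsubsetP (core_sub _ _ _) _ wU; rewrite !inE wU => /andP[-> wL] /=.
  have [//|wNV] := boolP (w \in V).
  by move: wNK; rewrite (bdK _ _ yV _ wy)// inE wNV wL.
have := fsubsetP (core_sub _ _ _) _ zU; rewrite !inE zU => /andP[-> zL] /=.
have [//|zNV] := boolP (z \in V).
by move: zNK; rewrite (bdK _ _ xV _ zx)// inE zNV zL.
Qed.

End Burning.

(** * Integration over finitely many heights *)
Section Expectation.
Local Open Scope fset_scope.
Local Open Scope ring_scope.
Variables (R : realFieldType) (S : choiceType) (D : seq (R * R)).
Implicit Types (s : seq S) (V W L : {fset S}) (x y z : S) (eta : S -> R).
Implicit Types (F G : (S -> R) -> R).

Definition upd eta x (v : R) : S -> R := fun y => if y == x then v else eta y.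

Lemma updC eta x y (u v : R) : x != y ->
  upd (upd eta x u) y v = upd (upd eta y v) x u.
Proof.
move=> xy; apply/funext => z; rewrite /upd.
by have [->|//] := eqVneq z y; rewrite eq_sym (negPf xy).
Qed.

(** The one-site law is a finite list of values with weights. Heights off s
    are 0, as in the extension of configurations by 0. Folding over a list
    rather than summing over functions on s makes the removal of one site a
    mere permutation. *)
Fixpoint integ_seq s F : R :=
  if s is x :: s' then \sum_(p <- D) p.2 * integ_seq s' (fun eta => F (upd eta x p.1))
  else F (fun=> 0).

Definition integ L F := integ_seq L F.

Lemma integ_seq_ext s F G : (forall eta, F eta = G eta) -> integ_seq s F = integ_seq s G.
Proof.
elim: s F G => [|x s IH] F G FG /=; first exact: FG.
by apply: eq_bigr => p _; congr (_ * _); apply: IH => eta; exact: FG.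
Qed.

Lemma integ_seqD s F G : integ_seq s (fun eta => F eta + G eta) = integ_seq s F + integ_seq s G.
Proof.
elim: s F G => [//|x s IH] F G /=; rewrite -big_split.
by apply: eq_bigr => p _; rewrite IH mulrDr.
Qed.

Lemma integ_seqZ s (c : R) F : integ_seq s (fun eta => c * F eta) = c * integ_seq s F.
Proof.
elim: s F => [//|x s IH] F /=; rewrite big_distrr /=.
by apply: eq_bigr => p _; rewrite IH mulrCA.
Qed.

Lemma integ_seqN s F : integ_seq s (fun eta => - F eta) = - integ_seq s F.
Proof. by rewrite -mulN1r -integ_seqZ; apply: integ_seq_ext => eta; rewrite mulN1r. Qed.

Lemma integ_seqB s F G : integ_seq s (fun eta => F eta - G eta) = integ_seq s F - integ_seq s G.
Proof. by rewrite integ_seqD integ_seqN. Qed.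

Lemma integ_seq0 s : integ_seq s (fun=> 0) = 0.
Proof.
rewrite -[RHS](mul0r (integ_seq s (fun=> 0))) -integ_seqZ.
by apply: integ_seq_ext => ?; rewrite mul0r.
Qed.

Lemma integ_seq_sum s (T : Type) (r : seq T) (P : pred T) (F : T -> (S -> R) -> R) :
  integ_seq s (fun eta => \sum_(i <- r | P i) F i eta) = \sum_(i <- r | P i) integ_seq s (F i).
Proof.
elim: r => [|i r IH].
  by rewrite big_nil -[RHS](integ_seq0 s); apply: integ_seq_ext => eta; rewrite big_nil.
rewrite big_cons -IH; case: ifP => Pi; last by apply: integ_seq_ext => eta; rewrite big_cons Pi.
by rewrite -integ_seqD; apply: integ_seq_ext => eta; rewrite big_cons Pi.
Qed.

Hypothesis D_ge0 : forall p, p \in D -> 0 <= p.2.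

Lemma integ_seq_ge0 s F : (forall eta, 0 <= F eta) -> 0 <= integ_seq s F.
Proof.
elim: s F => [|x s IH] F F0 /=; first exact: F0.
rewrite big_seq; apply: sumr_ge0 => p pD; apply: mulr_ge0; first exact: D_ge0.
by apply: IH => eta; exact: F0.
Qed.

Lemma ler_integ_seq s F G : (forall eta, F eta <= G eta) -> integ_seq s F <= integ_seq s G.
Proof.
by move=> FG; rewrite -subr_ge0 -integ_seqB; apply: integ_seq_ge0 => eta; rewrite subr_ge0.
Qed.

Lemma integ_seq_rem s x F : uniq s -> x \in s ->
  integ_seq s F = \sum_(p <- D) p.2 * integ_seq (rem x s) (fun eta => F (upd eta x p.1)).
Proof.
elim: s F => [//|y s IH] F /= /andP[ys us].
have [-> _|yx] := eqVneq y x; first by [].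
rewrite inE eq_sym (negPf yx) /= => xs.
under eq_bigr => p _ do rewrite IH// big_distrr /=.
rewrite exchange_big /=; apply: eq_bigr => q _; rewrite big_distrr /=.
apply: eq_bigr => p _; rewrite mulrCA; congr (_ * (_ * _)).
by apply: integ_seq_ext => eta; rewrite updC// eq_sym.
Qed.

Lemma integ_seq_perm s s' F : uniq s -> perm_eq s s' -> integ_seq s F = integ_seq s' F.
Proof.
elim: s s' F => [|x s IH] s' F us ss'.
  by move: ss'; rewrite perm_sym => /perm_nilP ->.
have xs' : x \in s' by rewrite -(perm_mem ss') mem_head.
rewrite (@integ_seq_rem s' x)//; last by rewrite -(perm_uniq ss').
move: us => /= /andP[_ us].
apply: eq_bigr => p _; congr (_ * _); apply: IH => //.
by rewrite -(perm_cons x) (perm_trans ss')// perm_to_rem.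
Qed.

Lemma integ_D1 L x F : x \in L ->
  integ L F = \sum_(p <- D) p.2 * integ (L `\ x) (fun eta => F (upd eta x p.1)).
Proof.
move=> xL; rewrite /integ (@integ_seq_rem _ x) ?fset_uniq//; apply: eq_bigr => p _.
congr (_ * _); apply: integ_seq_perm; first by rewrite rem_uniq// fset_uniq.
apply: uniq_perm; rewrite ?rem_uniq ?fset_uniq// => y.
by rewrite mem_rem_uniq ?fset_uniq// !inE.
Qed.

Definition depends_on (A : Type) V (F : (S -> R) -> A) :=
  forall eta eta', {in V, eta =1 eta'} -> F eta = F eta'.

Lemma integ_seq_cat s s' F G :
  (forall eta eta', {in s, eta =1 eta'} -> F eta = F eta') ->
  (forall eta x v, x \in s -> G (upd eta x v) = G eta) ->
  integ_seq (s ++ s') (fun eta => F eta * G eta) = integ_seq s F * integ_seq s' G.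
Proof.
elim: s F => [|x s IH] F locF locG /=.
  by rewrite -integ_seqZ; apply: integ_seq_ext => eta; congr (_ * _); exact: locF.
rewrite big_distrl /=; apply: eq_bigr => p _; rewrite -mulrA; congr (_ * _).
rewrite -IH; first by apply: integ_seq_ext => eta; rewrite locG ?mem_head.
  move=> eta eta' ee'; apply: locF => y; rewrite inE /upd.
  by case: ifP => // _ /= ys; exact: ee'.
by move=> eta y v ys; rewrite locG// inE ys orbT.
Qed.

(** Independence of the heights in disjoint sets of sites. *)
Lemma integ_mul W L F G : W `<=` L -> depends_on W F -> depends_on (L `\` W) G ->
  integ L (fun eta => F eta * G eta) = integ W F * integ (L `\` W) G.
Proof.
move=> WL locF locG; rewrite /integ -integ_seq_cat; last 2 first.
- exact: locF.
- move=> eta x v xW; apply: locG => y; rewrite !inE /upd.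
  by case: eqP => // ->; rewrite [x \in W]xW.
apply: integ_seq_perm; first exact: fset_uniq.
apply: uniq_perm; first exact: fset_uniq.
  rewrite cat_uniq !fset_uniq/= andbT; apply/hasPn => y.
  by rewrite !inE => /andP[].
move=> y; rewrite mem_cat.
rewrite -[y \in enum_fset W]/(y \in W) -[X in _ || X]/(y \in L `\` W) inE.
rewrite -[y \in enum_fset L]/(y \in L).
by have [/(fsubsetP WL)|] := boolP (y \in W).
Qed.

End Expectation.

(** * Finite-volume burning probabilities *)
Section FiniteVolume.
Local Open Scope fset_scope.
Local Open Scope ring_scope.
Variables (R : realFieldType) (S : choiceType) (e : rel S).
Hypothesis e_irr : irreflexive e.
Variables (N : nat) (h : R) (D : seq (R * R)).
Hypothesis degN : forall (W : {fset S}) y, (deg e W y <= N)%N.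
Hypothesis Nh : N%:R < h.
Hypothesis D_ge0 : forall p, p \in D -> 0 <= p.2.
Hypothesis D_tail : forall k, (k <= N)%N ->
  \sum_(p <- D | k%:R <= p.1) p.2 = h - k%:R.
Implicit Types (U V W K L : {fset S}) (x y z : S) (eta : S -> R).

Local Notation E := (integ D).
Local Notation core := (core e).
Local Notation deg := (deg e).
Local Notation burnable := (burnable e).
Local Notation sees := (sees e).

Definition total_weight L : R := E L (fun eta => (burnable L eta)%:R).

Definition stuck_weight L V K x : R :=
  E L (fun eta => ((x \in core V K eta) && burnable L eta)%:R).

(** The probability, under the uniform law on configurations on L that burn
    completely, that x remains unburnt when only V burns, against K. *)
Definition stuck_prob L V K x : R := stuck_weight L V K x / total_weight L.

Lemma h_gt0 : 0 < h. Proof. exact: le_lt_trans Nh. Qed.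

(** Integrate out the height at x using [burn_first]: given the other heights,
    those that let x burn in V have weight h minus the number of neighbours of
    x that lie in K or are stuck in V without x. *)
Lemma stuck_weight_rec L V K x : x \in V -> V `<=` L -> sees V L K ->
  [disjoint V & K] ->
  total_weight L - stuck_weight L V K x = (h - (deg K x)%:R) * total_weight (L `\ x) -
    \sum_(z <- V `\ x | e z x) stuck_weight (L `\ x) (V `\ x) (x |` K) z.
Proof.
move=> xV VL VLK VK.
transitivity (E L (fun eta => ((x \notin core V K eta) && burnable L eta)%:R)).
  rewrite /total_weight /stuck_weight -integ_seqB; apply: integ_seq_ext => eta.
  by case: (_ \in _); rewrite ?andbF ?subr0 ?subrr //=; rewrite subrr.
rewrite (integ_D1 _ _ (fsubsetP VL _ xV)).
have VxK : [disjoint V `\ x & K].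
  by apply/fdisjointP => y; rewrite !inE => /andP[_]; exact: (fdisjointP VK).
pose d eta := deg (core (V `\ x) (x |` K) eta `|` K) x.
transitivity (\sum_(p <- D) p.2 *
    E (L `\ x) (fun eta => (burnable (L `\ x) eta)%:R * ((d eta)%:R <= p.1)%R%:R)).
  apply: eq_bigr => p _; congr (_ * _); apply: integ_seq_ext => eta.
  have updE U : {in U `\ x, upd eta x p.1 =1 eta}.
    by move=> y; rewrite !inE /upd => /andP[/negPf ->].
  rewrite (burn_first e_irr _ xV VL VLK) -mulnb natrM /d.
  rewrite /burnable !(core_local _ _ (updE _)); congr (_ * (_ <= _)%R%:R).
  by rewrite /upd eqxx.
under eq_bigr => p _ do rewrite -integ_seqZ.
rewrite -integ_seq_sum /total_weight -integ_seqZ -integ_seq_sum -integ_seqB; apply: integ_seq_ext => eta.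
under eq_bigr => p _ do rewrite mulrCA.
rewrite -big_distrr /=.
have -> : \sum_(p <- D) p.2 * ((d eta)%:R <= p.1)%R%:R = h - (d eta)%:R.
  rewrite -D_tail ?degN// [RHS]big_mkcond; apply: eq_bigr => p _.
  by case: ifP; rewrite ?mulr1 ?mulr0.
rewrite /d (degDE _ _ (core_sub _ _ _ _) VxK) natrD natr_sum opprD addrA mulrDr.
rewrite mulrC mulrN big_distrr /=; congr (_ - _); apply: eq_bigr => z _.
by rewrite -natrM mulnb andbC.
Qed.

Lemma stuck_weight_ge0 L V K x : 0 <= stuck_weight L V K x.
Proof. by apply: integ_seq_ge0. Qed.

Lemma stuck_weight_le L V K x : stuck_weight L V K x <= total_weight L.
Proof. by apply: ler_integ_seq => // eta; case: (x \in _) => /=. Qed.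

Lemma stuck_weight_notin L V K x : x \notin V -> stuck_weight L V K x = 0.
Proof.
move=> xV; rewrite -[RHS](integ_seq0 D L); apply: integ_seq_ext => eta.
by rewrite (negPf (contra (fsubsetP (core_sub e V K eta) x) xV)).
Qed.

Lemma stuck_weight_full L x : stuck_weight L L fset0 x = 0.
Proof.
rewrite -[RHS](integ_seq0 D L); apply: integ_seq_ext => eta; rewrite /burnable.
by have [->|] := eqVneq (core L fset0 eta) fset0; rewrite ?inE ?andbF.
Qed.

(** The case V = L and K empty, in which x always burns. *)
Lemma total_weight_rec L x : x \in L -> total_weight L =
  h * total_weight (L `\ x) -
  \sum_(z <- L `\ x | e z x) stuck_weight (L `\ x) (L `\ x) [fset x] z.
Proof.
move=> xL; have := @stuck_weight_rec L L fset0 x xL (fsubset_refl L).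
rewrite stuck_weight_full subr0 => ->.
- rewrite fsetU0 (_ : deg fset0 x = 0%N) ?subr0//.
  by apply/eqP; rewrite cardfs_eq0; apply/eqP/fsetP => z; rewrite !inE.
- by move=> y z _; rewrite fsetDv inE.
- exact: fdisjointX0.
Qed.

Lemma sum_nbrs_le V x (F : S -> R) (c : R) : 0 <= c ->
  (forall z, z \in V -> e z x -> F z <= c) ->
  \sum_(z <- V | e z x) F z <= N%:R * c.
Proof.
move=> c0 Fc; apply: le_trans (_ : \sum_(z <- V | e z x) c <= _).
  by rewrite big_seq_cond [leRHS]big_seq_cond ler_sum// => z /andP[/Fc].
rewrite big_const_seq iter_addr_0 -[leLHS]mulr_natl ler_wpM2r// ler_nat.
by rewrite -sum1_count -degE.
Qed.

Lemma sum_nbrs_sub L L' y (F : S -> R) : L `<=` L' -> (forall z, 0 <= F z) ->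
  \sum_(z <- L | e z y) F z <= \sum_(z <- L' | e z y) F z.
Proof.
move=> LL' F0; rewrite [leRHS](big_fsetIDcond _ (mem L)) /=.
rewrite [X in _ <= X + _](_ : _ = \sum_(z <- L | e z y) F z).
  by rewrite lerDl sumr_ge0.
apply: eq_fbigl_cond => z; rewrite !inE /=.
by have [/(fsubsetP LL') ->|] := boolP (z \in L); rewrite ?andbF.
Qed.

(** In [total_weight_rec] at most N neighbours of x are stuck and N < h. *)
Lemma total_weight_gt0 L : 0 < total_weight L.
Proof.
move: {2}#|` L| (erefl #|` L|) => n; elim: n L => [|n IH] L Ln.
  rewrite /total_weight /integ (size0nil Ln) /= (cardfs0_eq Ln) /burnable.
  by rewrite -fsubset0 core_sub ltr01.
have [x xL] : exists x, x \in L by apply/fset0Pn; rewrite -cardfs_eq0 Ln.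
have Zx : 0 < total_weight (L `\ x) by apply: IH; rewrite (cardfsD1 x) xL in Ln; case: Ln.
rewrite (total_weight_rec xL) subr_gt0; apply: le_lt_trans (_ : N%:R * total_weight (L `\ x) < _).
  by apply: sum_nbrs_le; [exact: ltW|move=> z _ _; exact: stuck_weight_le].
by rewrite ltr_pM2r.
Qed.

Definition ratio L x := total_weight (L `\ x) / total_weight L.

Lemma total_weight_neq0 L : total_weight L != 0. Proof. exact/lt0r_neq0/total_weight_gt0. Qed.

Lemma ratio_gt0 L x : 0 < ratio L x.
Proof. by rewrite divr_gt0 ?total_weight_gt0. Qed.

Lemma stuck_prob_ge0 L V K x : 0 <= stuck_prob L V K x.
Proof. by rewrite divr_ge0 ?stuck_weight_ge0// ltW// total_weight_gt0. Qed.

Lemma stuck_prob_le1 L V K x : stuck_prob L V K x <= 1.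
Proof. by rewrite ler_pdivrMr ?total_weight_gt0// mul1r stuck_weight_le. Qed.

Lemma stuck_prob_notin L V K x : x \notin V -> stuck_prob L V K x = 0.
Proof. by move=> xV; rewrite /stuck_prob stuck_weight_notin// mul0r. Qed.

Lemma stuck_weightE L V K x : stuck_weight L V K x = stuck_prob L V K x * total_weight L.
Proof. by rewrite /stuck_prob divfK// total_weight_neq0. Qed.

Lemma stuck_prob_rec L V K x : x \in V -> V `<=` L -> sees V L K ->
  [disjoint V & K] ->
  1 - stuck_prob L V K x = ratio L x * (h - (deg K x)%:R -
    \sum_(z <- V `\ x | e z x) stuck_prob (L `\ x) (V `\ x) (x |` K) z).
Proof.
move=> xV VL VLK VK; have := stuck_weight_rec xV VL VLK VK.
under eq_bigr => z _ do rewrite stuck_weightE.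
rewrite -big_distrl /= stuck_weightE -[X in X - _]mul1r -!mulrBl => H.
by rewrite /ratio mulrAC -[total_weight _ * _]mulrC -H mulfK// total_weight_neq0.
Qed.

Lemma ratio_rec L x : x \in L ->
  ratio L x * (h - \sum_(z <- L `\ x | e z x) stuck_prob (L `\ x) (L `\ x) [fset x] z)
    = 1.
Proof.
move=> xL; have := total_weight_rec xL.
under eq_bigr => z _ do rewrite stuck_weightE.
rewrite -big_distrl /= -!mulrBl => H.
by rewrite /ratio mulrAC -[total_weight _ * _]mulrC -H divff// total_weight_neq0.
Qed.

(** The equation of a Green function with killing: b is the source. *)
Definition harmonic L (b u : S -> R) :=
  forall y, y \in L -> h * u y = b y + \sum_(z <- L | e z y) u z.

(** At a positive maximum the N neighbours cannot compensate h > N. *)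
Lemma max_principle L (u : S -> R) :
  (forall y, y \in L -> h * u y <= \sum_(z <- L | e z y) u z) ->
  forall y, y \in L -> u y <= 0.
Proof.
move=> sub y yL; rewrite leNgt; apply/negP => uy.
pose i0 : L := [` yL].
case: (@arg_maxP _ _ _ i0 predT (fun i : L => u (val i))) => //= i _ imax.
have ui : 0 < u (val i) by apply: lt_le_trans uy (imax i0 _).
have := sub _ (valP i); apply/negP; rewrite -ltNge.
apply: le_lt_trans (_ : N%:R * u (val i) < _); last by rewrite ltr_pM2r.
apply: sum_nbrs_le; first exact: ltW.
by move=> z zL _; exact: (imax [` zL]).
Qed.

Lemma harmonic_unique L b u u' : harmonic L b u -> harmonic L b u' ->
  {in L, u =1 u'}.
Proof.
move=> hu hu'; have le (v v' : S -> R) : harmonic L b v -> harmonic L b v' ->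
    forall y, y \in L -> v y - v' y <= 0.
  move=> hv hv'; apply: max_principle => y yL.
  by rewrite mulrBr hv// hv'// sumrB; lra.
by move=> y yL; have := le _ _ hu hu' y yL; have := le _ _ hu' hu y yL; lra.
Qed.

Lemma sum_nbrsD1 L x y (u : S -> R) : x \in L ->
  \sum_(z <- L | e z y) u z =
  (e x y)%:R * u x + \sum_(z <- L `\ x | e z y) u z.
Proof.
move=> xL; rewrite big_mkcond (big_fsetD1 x)//= -big_mkcond; congr (_ + _).
by case: ifP; rewrite ?mul1r ?mul0r.
Qed.

Lemma deg1 x y : deg [fset x] y = e x y :> nat.
Proof.
rewrite degE big_mkcond big_seq_fset1; by case: (e x y).
Qed.

(** Induction on L. Removing x turns [stuck_prob_rec] into the
    elimination of the unknown at x from the linear system: the solution with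
    source K on L restricts, on L minus x, to the solution with source K plus
    its value at x times the solution with source x. *)
Lemma stuck_prob_harmonic L K : [disjoint L & K] ->
  harmonic L (fun y => (deg K y)%:R) (stuck_prob L L K).
Proof.
move: {2}#|` L| (erefl #|` L|) => n; elim: n L K => [|n IH] L K Ln LK.
  by move=> y; rewrite (cardfs0_eq Ln) inE.
have IHx x K' : x \in L -> [disjoint L `\ x & K'] ->
    harmonic (L `\ x) (fun y => (deg K' y)%:R) (stuck_prob (L `\ x) (L `\ x) K').
  by move=> xL; apply: IH; rewrite (cardfsD1 x) xL in Ln; case: Ln.
have seesL M K' : sees M M K' by move=> ? ?; rewrite fsetDv inE.
pose qK x := stuck_prob (L `\ x) (L `\ x) K.
pose q1 x := stuck_prob (L `\ x) (L `\ x) [fset x].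
pose G x := stuck_prob L L K x.
(* The solution on L reconstructed from those on L minus x. *)
pose u x y := if y == x then G x else qK x y + G x * q1 x y.
have LxK x : [disjoint L `\ x & K].
  by apply/fdisjointP => y; rewrite !inE => /andP[_]; exact: (fdisjointP LK).
have Lx1 x : [disjoint L `\ x & [fset x]].
  by apply/fdisjointP => y; rewrite !inE => /andP[].
have hu x : x \in L -> harmonic L (fun y => (deg K y)%:R) (u x).
  move=> xL.
  have xK : x \notin K by exact: (fdisjointP LK).
  have LxxK : [disjoint L `\ x & x |` K].
    apply/fdisjointP => y yL; rewrite inE negb_or.
    by rewrite (fdisjointP (Lx1 x) _ yL) (fdisjointP (LxK x) _ yL).
  have degxK y : deg (x |` K) y = (e x y + deg K y)%N.
    rewrite !degE big_mkcond big_fsetU1//= -big_mkcond /=.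
    by case: (e x y).
  have hqK := IHx x K xL (LxK x); have hq1 := IHx x _ xL (Lx1 x).
  have qU : {in L `\ x, stuck_prob (L `\ x) (L `\ x) (x |` K) =1
                        fun z => qK x z + q1 x z}.
    apply: harmonic_unique (IHx x _ xL LxxK) _ => y yL.
    rewrite mulrDr hqK// hq1// big_split /= degxK deg1 natrD; lra.
  have sumu y : \sum_(z <- L `\ x | e z y) u x z =
      \sum_(z <- L `\ x | e z y) qK x z +
      G x * \sum_(z <- L `\ x | e z y) q1 x z.
    rewrite big_distrr -big_split /= big_seq_cond [RHS]big_seq_cond.
    by apply: eq_bigr => z; rewrite /u !inE -andbA => /andP[/negPf ->].
  move=> y yL; rewrite (sum_nbrsD1 _ _ xL) sumu {2}/u eqxx.
  have [->|yx] := eqVneq y x; last first.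
    have yLx : y \in L `\ x by rewrite !inE yx.
    rewrite /u (negPf yx) mulrDr hqK// mulrCA hq1// deg1; lra.
  rewrite e_irr mul0r add0r /u eqxx.
  have := stuck_prob_rec xL (fsubset_refl L) (seesL L K) LK.
  rewrite -/(G x).
  have -> : \sum_(z <- L `\ x | e z x) stuck_prob (L `\ x) (L `\ x) (x |` K) z =
     \sum_(z <- L `\ x | e z x) qK x z + \sum_(z <- L `\ x | e z x) q1 x z.
    rewrite -big_split /= big_seq_cond [RHS]big_seq_cond.
    by apply: eq_bigr => z /andP[zL _]; exact: qU.
  have := ratio_rec xL; rewrite -/(q1 x).
  have := ratio_gt0 L x.
  move: (ratio L x) (G x) (\sum_(z <- _ | _) qK x z) (\sum_(z <- _ | _) q1 x z).
  move=> r g a b r0 rb1 rab.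
  apply: (mulfI (lt0r_neq0 r0)).
  have -> : r * (h * g) = g * (r * (h - b)) + r * b * g by ring.
  rewrite rb1 mulr1; move: rab rb1; rewrite !mulrDr; lra.
(* Each u x solves the same system, so they agree; u y is the probability at y. *)
have eqG x y : x \in L -> y \in L -> stuck_prob L L K y = u x y.
  move=> xL yL; rewrite (harmonic_unique (hu x xL) (hu y yL) yL).
  by rewrite /u eqxx.
move=> y yL; rewrite (eqG y y yL yL) hu//; congr (_ + _).
rewrite big_seq_cond [RHS]big_seq_cond; apply: eq_bigr => z /andP[zL _].
by rewrite (eqG y z).
Qed.

(** A difference of two solutions is subharmonic on the smaller volume. *)
Lemma stuck_prob_mono L L' K x : L `<=` L' -> [disjoint L' & K] ->
  stuck_prob L L K x <= stuck_prob L' L' K x.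
Proof.
move=> LL' L'K; have [xL|xL] := boolP (x \in L); last first.
  by rewrite stuck_prob_notin// stuck_prob_ge0.
have LK : [disjoint L & K].
  by apply/fdisjointP => y /(fsubsetP LL'); exact: (fdisjointP L'K).
rewrite -subr_le0; move: x xL; apply: max_principle => y yL.
rewrite mulrBr !stuck_prob_harmonic//; last exact: (fsubsetP LL').
rewrite opprD addrACA subrr add0r sumrB lerD2l lerN2.
by apply: sum_nbrs_sub => // z; exact: stuck_prob_ge0.
Qed.

(** By [ratio_rec] the ratio increases with the probability that the
    neighbours of x need x to burn, which is monotone by [stuck_prob_mono]. *)
Lemma ratio_mono L L' x : x \in L -> L `<=` L' -> ratio L x <= ratio L' x.
Proof.
move=> xL LL'; have xL' := fsubsetP LL' _ xL.
set s := fun M : {fset S} =>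
  \sum_(z <- M `\ x | e z x) stuck_prob (M `\ x) (M `\ x) [fset x] z.
have ss' : s L <= s L'.
  apply: le_trans (_ : \sum_(z <- L `\ x | e z x)
                          stuck_prob (L' `\ x) (L' `\ x) [fset x] z <= _).
    apply: ler_sum => z _; apply: stuck_prob_mono; first exact: fsetSD.
    by apply/fdisjointP => y; rewrite !inE => /andP[].
  by apply: sum_nbrs_sub; [exact: fsetSD|move=> z; exact: stuck_prob_ge0].
have := ratio_rec xL; have := ratio_rec xL'; rewrite -/(s L) -/(s L').
have := ratio_gt0 L x; have := ratio_gt0 L' x.
move: (ratio L x) (ratio L' x) (s L) (s L') ss' => r r' a b ab r'0 r0 H' H.
have hb : 0 < h - b by rewrite -(pmulr_rgt0 _ r'0) H'.
have ha : 0 < h - a by rewrite -(pmulr_rgt0 _ r0) H.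
have -> : r = (h - a)^-1 by rewrite -[RHS]mul1r -H mulfK// gt_eqF.
have -> : r' = (h - b)^-1 by rewrite -[RHS]mul1r -H' mulfK// gt_eqF.
by rewrite lef_pV2 ?posrE//; lra.
Qed.

Lemma ratio_le L x : x \in L -> ratio L x <= (h - N%:R)^-1.
Proof.
move=> xL; have := ratio_rec xL; have := ratio_gt0 L x.
have : \sum_(z <- L `\ x | e z x) stuck_prob (L `\ x) (L `\ x) [fset x] z <= N%:R.
  rewrite -[leRHS]mulr1; apply: sum_nbrs_le => // z _ _; exact: stuck_prob_le1.
move: (ratio _ _) (\sum_(_ <- _ | _) _) => r s sN r0 H.
have hs : 0 < h - s by rewrite -(pmulr_rgt0 _ r0) H.
have -> : r = (h - s)^-1 by rewrite -[RHS]mul1r -H mulfK// gt_eqF.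
by rewrite lef_pV2 ?posrE ?subr_gt0//; lra.
Qed.

(** The volume around V can only help V to burn by itself: conditioning on
    a larger volume burning favours high heights. Both sides obey
    [stuck_prob_rec], with the larger ratio on the left. *)
Lemma stuck_prob_restrict L V K x : V `<=` L -> sees V L K -> [disjoint V & K] ->
  stuck_prob L V K x <= stuck_prob V V K x.
Proof.
move: {2}#|` V| (erefl #|` V|) => n; elim: n L V K x => [|n IH] L V K x Vn VL VLK VK.
  by rewrite stuck_prob_notin ?stuck_prob_ge0// (cardfs0_eq Vn) inE.
have [xV|xV] := boolP (x \in V); last by rewrite stuck_prob_notin// stuck_prob_ge0.
rewrite -lerN2 -(lerD2l 1) !stuck_prob_rec//; last by move=> ? ?; rewrite fsetDv inE.
have VxK : [disjoint V `\ x & x |` K].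
  apply/fdisjointP => y; rewrite !inE => /andP[yx yV].
  by rewrite negb_or yx (fdisjointP VK).
have le_sum : \sum_(z <- V `\ x | e z x) stuck_prob (L `\ x) (V `\ x) (x |` K) z <=
          \sum_(z <- V `\ x | e z x) stuck_prob (V `\ x) (V `\ x) (x |` K) z.
  apply: ler_sum => z _; apply: IH => //.
  - by rewrite (cardfsD1 x) xV in Vn; case: Vn.
  - exact: fsetSD.
  - move=> y w; rewrite !inE => /andP[yx yV] /andP[+ /andP[wx wL]] wy.
    by rewrite wx /= => wV; rewrite (VLK y w)// ?inE ?wV ?orbT.
have nonneg : 0 <= h - (deg K x)%:R -
    \sum_(z <- V `\ x | e z x) stuck_prob (V `\ x) (V `\ x) (x |` K) z.
  have : 0 <= ratio V x * (h - (deg K x)%:R -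
      \sum_(z <- V `\ x | e z x) stuck_prob (V `\ x) (V `\ x) (x |` K) z).
    rewrite -stuck_prob_rec// ?subr_ge0 ?stuck_prob_le1//; by move=> ? ?; rewrite fsetDv inE.
  by rewrite pmulr_rge0// ratio_gt0.
apply: ler_pM => //; first exact/ltW/ratio_gt0.
  exact: ratio_mono.
by rewrite lerD2l lerN2.
Qed.

(** A walk killed with probability 1 - N / h at each step needs more than n
    steps to leave A n from A 0. *)
Lemma stuck_prob_decay (A : nat -> {fset S}) n K x :
  (forall k y z, y \in A k -> e z y -> z \in A k.+1) ->
  (forall k, A k `<=` A k.+1) ->
  [disjoint A n & K] -> x \in A 0%N ->
  stuck_prob (A n) (A n) K x <= (N%:R / h) ^+ n.
Proof.
move=> Anb AS AK xA.
have th0 : 0 <= N%:R / h :> R by rewrite divr_ge0// ltW// h_gt0.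
suff /(_ 0%N (leq0n _)) : forall k, (k <= n)%N ->
    forall y, y \in A k -> stuck_prob (A n) (A n) K y <= (N%:R / h) ^+ (n - k).
  by rewrite subn0; apply.
have Amon k l : (k <= l)%N -> A k `<=` A l.
  move=> /subnK <-; elim: (l - k)%N => [|m IH]; first exact: fsubset_refl.
  exact: fsubset_trans IH (AS _).
move=> k; move: {2}(n - k)%N (erefl (n - k)%N) => m.
elim: m k => [|m IH] k nkm kn y yA; first by rewrite nkm expr0 stuck_prob_le1.
have kn' : (k < n)%N by rewrite -subn_gt0 nkm.
have yAn : y \in A n by exact: (fsubsetP (Amon k n kn)).
rewrite nkm exprS -(ler_pM2l h_gt0) stuck_prob_harmonic// (_ : deg K y = 0%N); last first.
  apply/eqP; rewrite cardfs_eq0; apply/eqP/fsetP => z; rewrite !inE /=.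
  apply/negP => /andP[zK zy].
  have /(fsubsetP (Amon k.+1 n kn')) zAn : z \in A k.+1 by exact: Anb zy.
  by have := fdisjointP AK _ zAn; rewrite zK.
rewrite add0r !mulrA [h * _]mulrC mulfK ?lt0r_neq0 ?h_gt0//.
apply: sum_nbrs_le; first exact: exprn_ge0.
move=> z _ zy; have -> : m = (n - k.+1)%N by rewrite subnS nkm.
by apply: IH; rewrite ?subnS ?nkm//; exact: Anb zy.
Qed.

End FiniteVolume.

(** * Limits along finite volumes *)
Section TotallyCvg.
Variables (R : realType) (S : choiceType).
Implicit Types (u v : {fset S} -> R) (L : {fset S}).
Local Open Scope fset_scope.
Local Open Scope ring_scope.

#[local] Existing Instance totally_filter.

Lemma near_totally (A : {fset S}) (P : {fset S} -> Prop) :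
  (forall L, A `<=` L -> P L) -> \forall L \near totally, P L.
Proof. by move=> AP; exists A. Qed.

Lemma totally_mono_cvg u (A : {fset S}) (M : R) :
  (forall L L', A `<=` L -> L `<=` L' -> u L <= u L') ->
  (forall L, A `<=` L -> u L <= M) -> cvg (u @ totally).
Proof.
move=> umono uM; pose E := [set u L | L in [set L | (A `<=` L)%fset]]%classic.
have supE : has_sup E.
  split; first by exists (u A), A => //=; exact: fsubset_refl.
  by exists M => _ [L /= AL <-]; exact: uM.
apply/cvg_ex; exists (sup E); apply/cvgrPdist_lt => eps eps0.
have [_ [L0 /= AL0 <-] uL0] := sup_adherent eps0 supE.
apply: (@near_totally L0) => L L0L.
have AL : A `<=` L := fsubset_trans AL0 L0L.
have le1 := umono _ _ AL0 L0L.
have le2 : u L <= sup E by apply: (sup_upper_bound supE); exists L.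
by rewrite ger0_norm ?subr_ge0//; lra.
Qed.

Lemma approx_cvg u : (forall eps : R, 0 < eps -> exists2 v, cvg (v @ totally) &
    \forall L \near totally, `|u L - v L| <= eps) -> cvg (u @ totally).
Proof.
move=> approx; apply: cauchy_cvg; apply/cauchy_ballP => eps eps0.
have e4 : 0 < eps / 4 by rewrite divr_gt0.
have [v /cvg_ex[l vl] uv] := approx _ e4.
have vl4 := @cvgr_dist_lt _ _ _ _ _ _ _ vl _ e4.
have [A _ H] := filterI uv (vl4 _).
pose B := [set u L | L in [set L | (A `<=` L)%fset]]%classic.
exists (B, B).
  by split => /=; (exists A => // L AL; exists L).
move=> [_ _] /= [[L /= AL <-] [L' /= AL' <-]].
have [uv1 lv1] := H _ AL; have [uv2 lv2] := H _ AL'.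
rewrite /ball /=; have -> : u L - u L' =
   (u L - v L) - (l - v L) + (l - v L') - (u L' - v L') by ring.
apply: le_lt_trans (ler_normB _ _) _.
have t1 : `|u L - v L - (l - v L) + (l - v L')| <= `|u L - v L| + `|l - v L| + `|l - v L'|.
  by rewrite (le_trans (ler_normD _ _))// lerD2r ler_normB.
lra.
Qed.

Lemma cvg_totally_eq u v (A : {fset S}) : (forall L, A `<=` L -> u L = v L) ->
  cvg (v @ totally) -> cvg (u @ totally).
Proof.
move=> uv /cvg_ex[l vl]; apply/cvg_ex; exists l; apply: cvg_trans vl.
by apply: near_eq_cvg; apply: (@near_totally A) => L /uv ->.
Qed.

End TotallyCvg.

(** * Means of local functions in infinite volume *)
Section InfiniteVolume.
Variables (R : realType) (S : choiceType) (e : rel S).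
Hypothesis e_irr : irreflexive e.
Variables (N : nat) (h : R) (D : seq (R * R)) (nb : S -> {fset S}).
Hypothesis degN : forall (W : {fset S}) y, (deg e W y <= N)%N.
Hypothesis Nh : N%:R < h.
Hypothesis D_ge0 : forall p, p \in D -> 0 <= p.2.
Hypothesis D_tail : forall k, (k <= N)%N ->
  \sum_(p <- D | k%:R <= p.1) p.2 = h - k%:R.
Hypothesis nbP : forall y z, e z y -> z \in nb y.
Implicit Types (U V W K L : {fset S}) (x y z : S) (eta : S -> R).
Implicit Types (F : (S -> R) -> R).
Local Open Scope fset_scope.
Local Open Scope ring_scope.

#[local] Existing Instance totally_filter.

Local Notation E := (integ D).
Local Notation core := (core e).
Local Notation burnable := (burnable e).
Local Notation total_weight := (total_weight e D).
Local Notation ratio := (ratio e D).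
Local Notation stuck_prob := (stuck_prob e D).

Definition mean L F := E L (fun eta => F eta * (burnable L eta)%:R) / total_weight L.

(** A finite superset of the outer boundary of W. *)
Definition bd W := \bigcup_(y <- W) nb y `\` W.

Lemma mem_bd W y z : y \in W -> e z y -> z \notin W -> z \in bd W.
Proof.
move=> yW /nbP zy zW; rewrite inE zW; apply/bigfcupP.
by exists y => //; rewrite andbT.
Qed.

Definition selfburn W eta := core W (bd W) eta == fset0.

(** W burns by itself in every ambient process that does not protect it. *)
Lemma core_selfburn V K W eta : selfburn W eta -> [disjoint K & W] ->
  core V K eta `&` W = fset0.
Proof.
move=> /eqP sW KW; apply/eqP; rewrite -fsubset0 -[X in _ `<=` X]sW.
apply: core_cut => y z _ yW zUK zy; rewrite in_fsetU in_fsetI.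
have [zW|zW] := boolP (z \in W); last by rewrite (mem_bd yW)// orbT.
move: zUK; rewrite inE => /orP[->//|zK].
by have := fdisjointP KW _ zK; rewrite zW.
Qed.

Lemma selfburn_burnable W L eta : W `<=` L -> selfburn W eta ->
  burnable L eta = burnable (L `\` W) eta.
Proof.
move=> WL sW; apply/idP/idP => [/eqP bL|/eqP bLW].
  rewrite /burnable -fsubset0 -[X in _ `<=` X]bL.
  rewrite -(fsetIidPl (_ : core (L `\` W) fset0 eta `<=` L)); last first.
    by rewrite (fsubset_trans (core_sub _ _ _ _))// fsubsetDl.
  by apply: core_cut => y z _ _; rewrite !fsetU0 inE => zU _;
    rewrite zU (fsubsetP _ _ (fsubsetP (core_sub _ _ _ _) _ zU))// fsubsetDl.
have UW := core_selfburn L sW (fdisjoint0X _).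
have UD : core L fset0 eta `<=` L `\` W.
  by rewrite fsubsetD core_sub -fsetI_eq0 UW eqxx.
rewrite /burnable -fsubset0 -[X in _ `<=` X]bLW -(fsetIidPl UD).
apply: core_cut => y z _ _; rewrite !fsetU0 inE => zU _.
by rewrite zU (fsubsetP UD).
Qed.

Lemma selfburnU W W' eta : selfburn W eta -> selfburn W' eta ->
  selfburn (W `|` W') eta.
Proof.
move=> sW sW'; rewrite /selfburn; set U := core _ _ _.
have -> : U = (U `&` W) `|` (U `&` W').
  by rewrite -fsetIUr; apply/esym/fsetIidPl/core_sub.
have dis M : M `<=` W `|` W' -> [disjoint bd (W `|` W') & M].
  move=> MW; apply/fdisjointP => z; rewrite !inE => /andP[zW _].
  by apply: contra zW => /(fsubsetP MW); rewrite inE.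
by rewrite /U !core_selfburn ?fsetU0//; apply: dis; rewrite ?fsubsetUl ?fsubsetUr.
Qed.

Lemma selfburn_dep W : depends_on W (selfburn W).
Proof. by move=> eta eta' ee; rewrite /selfburn (core_local _ _ ee). Qed.

(** What burns inside V against its boundary has been burnt without any help
    from outside: it is a self-burning set, and the largest one in V. *)
Lemma selfburn_noncore V eta : selfburn (V `\` core V (bd V) eta) eta.
Proof.
set U := core V _ _; set M := V `\` U; set C := core M (bd M) eta.
have CM : C `<=` M by exact: core_sub.
have UV : U `<=` V by exact: core_sub.
have CUV : C `|` U `<=` V.
  by rewrite fsubUset UV (fsubset_trans CM)// fsubsetDl.
suff : C `|` U `<=` U.
  rewrite fsubUset => /andP[CU _]; rewrite /selfburn -/C.
  apply/eqP/fsetP => z; rewrite inE; apply/negP => zC.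
  by have := fsubsetP CM _ zC; rewrite inE (fsubsetP CU).
apply: core_max => //; apply/stuckP => y; rewrite inE => /orP[yC|yU].
  apply: ltr_deg (core_lt yC) _ => z; rewrite !in_fsetU => /orP[->//|zb] zy.
  have [zV|zV] := boolP (z \in V); last first.
    rewrite (mem_bd _ zy zV) ?orbT//.
    by apply: (fsubsetP CUV); rewrite inE yC.
  move: zb; rewrite inE => /andP[zM _]; move: zM; rewrite inE zV andbT negbK => ->.
  by rewrite orbT.
apply: ltr_deg (core_lt yU) _ => z; rewrite !in_fsetU => /orP[]-> _;
  by rewrite ?orbT.
Qed.

Lemma ratio_cvg W x : x \notin W -> cvg ((fun L => ratio (L `\` W) x) @ totally).
Proof.
move=> xW; apply: (@totally_mono_cvg _ _ _ [fset x] (h - N%:R)^-1).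
  move=> L L'; rewrite fsub1set => xL LL'.
  apply: (ratio_mono e_irr degN Nh D_ge0 D_tail); first by rewrite inE xW.
  exact: fsetSD.
move=> L; rewrite fsub1set => xL.
by apply: (ratio_le e_irr degN Nh D_ge0 D_tail); rewrite inE xW.
Qed.

(** Remove the sites of W one at a time. *)
Lemma total_weight_ratio_cvg W : cvg ((fun L => total_weight (L `\` W) / total_weight L) @ totally).
Proof.
have Z0 L : total_weight L != 0 by exact: (total_weight_neq0 e_irr degN Nh D_ge0 D_tail).
move: {2}#|` W| (erefl #|` W|) => n; elim: n W => [|n IH] W Wn.
  rewrite (cardfs0_eq Wn); apply/cvg_ex; exists 1.
  under eq_fun do rewrite fsetD0 divff//.
  exact: cvg_cst.
have [x xW] : exists x, x \in W by apply/fset0Pn; rewrite -cardfs_eq0 Wn.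
have WE L : total_weight (L `\` W) / total_weight L =
    ratio (L `\` (W `\ x)) x * (total_weight (L `\` (W `\ x)) / total_weight L).
  have -> : L `\` W = (L `\` (W `\ x)) `\ x.
    by rewrite fsetDDl fsetUC fsetD1K.
  by rewrite /ratio mulrA divfK.
have cx : cvg ((fun L => ratio (L `\` (W `\ x)) x) @ totally).
  by apply: ratio_cvg; rewrite !inE eqxx.
have cW : cvg ((fun L => total_weight (L `\` (W `\ x)) / total_weight L) @ totally).
  by apply: IH; rewrite (cardfsD1 x) xW in Wn; case: Wn.
under eq_fun do rewrite WE.
exact: is_cvgM cx cW.
Qed.

(** On the support of F the heights in W put no constraint on the others, so
    the mean factorizes. *)
Lemma selfburn_cvg W F : depends_on W F ->
  (forall eta, ~~ selfburn W eta -> F eta = 0) ->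
  cvg (mean^~ F @ totally).
Proof.
move=> FW F0.
have meanE L : W `<=` L -> mean L F = E W F * (total_weight (L `\` W) / total_weight L).
  move=> WL; rewrite /mean mulrA; congr (_ / _).
  rewrite -(integ_mul _ WL FW); last first.
    by move=> eta eta' ee; rewrite /burnable (core_local _ _ ee).
  apply: integ_seq_ext => eta; have [sW|/F0 ->] := boolP (selfburn W eta).
    by rewrite (selfburn_burnable WL).
  by rewrite !mul0r.
apply: cvg_totally_eq meanE _; apply: is_cvgM; last exact: total_weight_ratio_cvg.
exact: is_cvg_cst.
Qed.

Lemma meanD L F G : mean L (fun eta => F eta + G eta) = mean L F + mean L G.
Proof.
rewrite /mean -mulrDl -integ_seqD; congr (_ / _).
by apply: integ_seq_ext => eta; rewrite mulrDl.
Qed.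

Lemma meanB L F G : mean L (fun eta => F eta - G eta) = mean L F - mean L G.
Proof.
rewrite /mean -mulrBl -integ_seqB; congr (_ / _).
by apply: integ_seq_ext => eta; rewrite mulrBl.
Qed.

Lemma mean_le L F G : (forall eta, F eta <= G eta) -> mean L F <= mean L G.
Proof.
move=> FG; apply: ler_wpM2r.
  by rewrite invr_ge0 ltW// (total_weight_gt0 e_irr degN Nh D_ge0 D_tail).
by apply: ler_integ_seq => // eta; apply: ler_wpM2r; [exact: ler0n|exact: FG].
Qed.

(** Inclusion and exclusion over the list l. The list l' records the sets
    already required to be self-burning: their union with W is then
    self-burning, and [selfburn_cvg] applies to each term. *)
Lemma any_selfburn_cvg V F (l l' : seq {fset S}) : depends_on V F ->
  {in l, forall W, V `<=` W} ->
  cvg ((fun L => mean L (fun eta => F eta * (has (selfburn^~ eta) l)%:R *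
     (all (selfburn^~ eta) l')%:R)) @ totally).
Proof.
move=> FV; elim: l l' => [|W l IH] l' /= lV.
  apply: (@cvg_totally_eq _ _ _ (cst 0) fset0); last exact: is_cvg_cst.
  move=> L _; rewrite /mean -[RHS](mul0r (total_weight L)^-1); congr (_ / _).
  by rewrite -[RHS](integ_seq0 D L); apply: integ_seq_ext => eta; rewrite mulr0 !mul0r.
have split_has L : mean L (fun eta => F eta * (selfburn W eta || has (selfburn^~ eta) l)%:R *
       (all (selfburn^~ eta) l')%:R) =
   mean L (fun eta => F eta * (all (selfburn^~ eta) (W :: l'))%:R) +
   mean L (fun eta => F eta * (has (selfburn^~ eta) l)%:R * (all (selfburn^~ eta) l')%:R) -
   mean L (fun eta => F eta * (has (selfburn^~ eta) l)%:R * (all (selfburn^~ eta) (W :: l'))%:R).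
  rewrite -meanD -meanB; congr (mean L _); apply/funext => eta /=.
  by case: (selfburn W eta) (has _ _) (all _ _) => [] [] []; rewrite /=; ring.
apply: (cvg_totally_eq (fun L (_ : fset0 `<=` L) => split_has L)).
have lV' : {in l, forall W, V `<=` W}.
  by move=> M Ml; apply: lV; rewrite inE Ml orbT.
apply: is_cvgB; last exact: IH.
apply: is_cvgD; last exact: IH.
pose M := \bigcup_(X <- W :: l') X.
have subM X : X \in W :: l' -> X `<=` M by move=> Xl; exact: bigfcup_sup.
have VM : V `<=` M.
  by apply: fsubset_trans (subM _ (mem_head _ _)); apply: lV; rewrite mem_head.
apply: (@selfburn_cvg M).
  move=> eta eta' ee; congr (_ * _%:R).
    by apply: FV => y /(fsubsetP VM) /ee.
  congr nat_of_bool; apply: eq_in_all => X Xl; apply: selfburn_dep => y.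
  by move=> /(fsubsetP (subM _ Xl)) /ee.
move=> eta; have [aX|_] := boolP (all _ _); last by rewrite mulr0.
move=> /negP[]; rewrite /M; elim: (W :: l') aX => [_|X r IHr /= /andP[sX ar]].
  by rewrite big_nil /selfburn -fsubset0 core_sub.
by rewrite big_cons; apply: selfburnU => //; exact: IHr.
Qed.

(** Compare F with its restriction to the event that some self-burning set
    inside a large ball around V contains V. *)
Lemma local_cvg V F (C : R) : depends_on V F -> (forall eta, `|F eta| <= C) ->
  cvg (mean^~ F @ totally).
Proof.
move=> FV FC; have C0 : 0 <= C by apply: le_trans (FC (fun=> 0)).
apply: approx_cvg => eps eps0.
(* Balls around V in the graph distance. *)
pose A n := iter n (fun W => W `|` \bigcup_(y <- W) nb y) V.
have AS k : A k `<=` A k.+1 by exact: fsubsetUl.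
have Anb k y z : y \in A k -> e z y -> z \in A k.+1.
  move=> yA /nbP zy; rewrite /= inE; apply/orP; right; apply/bigfcupP.
  by exists y => //; rewrite andbT.
have VA n : V `<=` A n.
  by elim: n => [|n IH]; [exact: fsubset_refl|exact: fsubset_trans IH (AS n)].
have [n Hn] : exists n, C * (#|` V|%:R * (N%:R / h) ^+ n) <= eps.
  have h0 := le_lt_trans (ler0n R N) Nh.
  have : (fun n => C * (#|` V|%:R * (N%:R / h) ^+ n)) @ \oo --> C * (#|` V|%:R * 0).
    apply: cvgMr; apply: cvgMr; apply: cvg_expr.
    by rewrite ger0_norm ?divr_ge0 ?(ltW h0)// ltr_pdivrMr// mul1r.
  rewrite !mulr0 => /cvgr0_norm_le /(_ _ eps0) [n _ /(_ n (leqnn n))] /= Hn.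
  by exists n; apply: le_trans Hn; exact: ler_norm.
pose M := A n; pose l := [seq W <- fpowerset M | V `<=` W].
exists (fun L => mean L (fun eta => F eta * (has (selfburn^~ eta) l)%:R)).
  apply: (@cvg_totally_eq _ _ _ (fun L => mean L (fun eta =>
      F eta * (has (selfburn^~ eta) l)%:R * (all (selfburn^~ eta) [::])%:R)) fset0).
    by move=> L _; congr (mean L _); apply/funext => eta; rewrite mulr1.
  by apply: any_selfburn_cvg FV _ => W; rewrite mem_filter => /andP[].
apply: (@near_totally _ M) => L ML; rewrite -meanB.
pose B eta := \sum_(x <- V) C * (x \in core M (bd M) eta)%:R.
have FB eta : `|F eta - F eta * (has (selfburn^~ eta) l)%:R| <= B eta.
  have B0 : 0 <= B eta by apply: sumr_ge0 => x _; rewrite mulr_ge0.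
  have [_|nhas] := boolP (has _ _); first by rewrite mulr1 subrr normr0.
  rewrite mulr0 subr0; apply: le_trans (FC eta) _.
  have [x xV xU] : exists2 x, x \in V & x \in core M (bd M) eta.
    apply: contrapT => nx; move/negP: nhas; apply.
    apply/hasP; exists (M `\` core M (bd M) eta); last exact: selfburn_noncore.
    rewrite mem_filter fpowersetE fsubsetDl andbT; apply/fsubsetP => y yV.
    rewrite inE (fsubsetP (VA n) _ yV) andbT; apply/negP => yU.
    by apply: nx; exists y.
  rewrite /B (big_fsetD1 x)//= xU mulr1 lerDl.
  by apply: sumr_ge0 => y _; rewrite mulr_ge0.
have meanB0 : mean L B <= eps.
  apply: le_trans Hn.
  have -> : mean L B = \sum_(x <- V) C * stuck_prob L M (bd M) x.
    rewrite /mean [X in X / _](_ : _ = \sum_(x <- V) C * stuck_weight e D L M (bd M) x).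
      by rewrite big_distrl /=; apply: eq_bigr => x _; rewrite -mulrA.
    rewrite /stuck_weight; under eq_bigr => x _ do rewrite -integ_seqZ.
    rewrite -integ_seq_sum; apply: integ_seq_ext => eta; rewrite /B big_distrl /=.
    by apply: eq_bigr => x _; rewrite -mulrA -natrM mulnb.
  apply: le_trans (_ : \sum_(x <- V) C * (N%:R / h) ^+ n <= _).
    rewrite big_seq [leRHS]big_seq; apply: ler_sum => x xV.
    rewrite ler_wpM2l//.
    have MK : [disjoint M & bd M].
      by apply/fdisjointP => y yM; rewrite inE yM.
    apply: le_trans (stuck_prob_decay e_irr degN Nh D_ge0 D_tail Anb AS MK xV).
    apply: (stuck_prob_restrict e_irr degN Nh D_ge0 D_tail) => // y z yM.
    by rewrite inE => /andP[zM _] zy; exact: mem_bd yM zy zM.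
  rewrite big_const_seq count_predT iter_addr_0 -[leLHS]mulr_natl.
  by rewrite mulrCA.
rewrite ler_norml; apply/andP; split; last first.
  apply: le_trans meanB0; apply: mean_le => eta.
  exact: le_trans (ler_norm _) (FB eta).
rewrite lerNl; apply: le_trans meanB0.
rewrite -subr_ge0 opprK -meanD.
apply: divr_ge0; last exact/ltW/(total_weight_gt0 e_irr degN Nh D_ge0 D_tail).
apply: integ_seq_ge0 => // eta; apply: mulr_ge0 => //.
by have := FB eta; rewrite ler_norml => /andP[+ _]; lra.
Qed.

End InfiniteVolume.

(** * Discretization of one height *)
Section OneSite.
Variables (R : realType).
Implicit Types (J : R * R) (l : seq (R * R)) (c t : R).

Definition split_at c l : seq (R * R) :=
  flatten [seq if J.1 < c < J.2 then [:: (J.1, c); (c, J.2)] else [:: J] | J <- l].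

(** The partition of [0, h) cut at the points of T: half-open intervals coded by
    their end points. *)
Definition cells (h : R) (T : seq R) := foldr split_at [:: (0, h)] T.

Definition inside J t := J.1 <= t < J.2.

Lemma mem_split_at c l K : K \in split_at c l ->
  exists2 J, J \in l & [\/ K = J /\ ~~ (J.1 < c < J.2),
    K = (J.1, c) /\ J.1 < c < J.2 | K = (c, J.2) /\ J.1 < c < J.2].
Proof.
move=> /flatten_mapP[J Il]; have [cI|cI] := boolP (J.1 < c < J.2).
  rewrite !inE => /orP[]/eqP ->; exists J => //; first by apply: Or32.
  by apply: Or33.
by rewrite inE => /eqP ->; exists J => //; apply: Or31.
Qed.

Lemma cells_wf h T J : 0 < h -> J \in cells h T -> [/\ 0 <= J.1, J.1 < J.2 & J.2 <= h].
Proof.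
move=> h0; elim: T J => [|c T IH] J /=; first by rewrite inE => /eqP -> /=.
by move=> /mem_split_at[K /IH[J0 J1 Jh]] [[-> _]|[-> /andP[? ?]]|[-> /andP[? ?]]] /=;
  split=> //; lra.
Qed.

Lemma cells_nosplit h T c J : c \in T -> J \in cells h T -> ~~ (J.1 < c < J.2).
Proof.
elim: T J => [//|c' T IH] J /=; rewrite inE => /orP[/eqP ->|cT].
  move=> /mem_split_at[K _] [[-> //]|[-> _]|[-> _]] /=; by rewrite ltxx ?andbF.
move=> /mem_split_at[K /(IH _ cT) cJ] [[-> //]|[-> H]|[-> H]] /=;
  apply: contra cJ => /andP[u v]; move: H => /andP[? ?]; apply/andP; split=> //; lra.
Qed.

Lemma sum_cells (V : zmodType) h T (phi : R -> R -> V) :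
  (forall a c b, a < c < b -> phi a b = phi a c + phi c b) ->
  \sum_(J <- cells h T) phi J.1 J.2 = phi 0 h.
Proof.
move=> phiD; elim: T => [|c T IH] /=; first by rewrite big_seq1.
rewrite /split_at big_flatten big_map /= -IH; apply: eq_bigr => J _.
by case: ifP => [/phiD ->|_]; rewrite ?big_cons big_nil ?addr0.
Qed.

Lemma cells_partition h T t : 0 <= t < h ->
  (\sum_(J <- cells h T) inside J t = 1)%N.
Proof.
move=> t0h; apply/eqP; rewrite -(eqr_nat R) natr_sum /inside.
rewrite (@sum_cells _ h T (fun a b => (a <= t < b)%R%:R : R)) ?t0h//.
move=> a c b /andP[ac cb]; rewrite -natrD; congr _%:R.
case: (leP a t) (ltP t c) (leP c t) (ltP t b) => ? [] ? [] ? [] ? //=; exfalso; lra.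
Qed.

Lemma cells_disjoint h T (i j : 'I_(size (cells h T))) t : 0 <= t < h ->
  inside (nth (0, 0) (cells h T) i) t -> inside (nth (0, 0) (cells h T) j) t ->
  i = j.
Proof.
move=> t0h it jt; apply/eqP/negPn/negP => ij.
have := cells_partition T t0h; rewrite (big_nth (0, 0)) big_mkord.
by rewrite (bigD1 i)//= (bigD1 j)//= 1?eq_sym// it jt.
Qed.

Lemma cells_cover h T t : 0 <= t < h -> exists2 J, J \in cells h T & inside J t.
Proof.
move=> t0h; apply/hasP; have T1 := cells_partition T t0h.
rewrite has_count -sum1_count big_mkcond (eq_bigr (fun J => inside J t : nat)).
  by rewrite T1.
by move=> J _; case: inside.
Qed.

Definition weights h T := [seq (J.1, J.2 - J.1) | J <- cells h T].

Lemma weights_ge0 h T p : 0 < h -> p \in weights h T -> 0 <= p.2.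
Proof.
by move=> h0 /mapP[J /(cells_wf h0)[_ I12 _] ->] /=; rewrite subr_ge0 ltW.
Qed.

(** The maximum covers thresholds beyond h, where both sides vanish. *)
Lemma weights_tail h T k : 0 < h -> k \in T -> 0 <= k ->
  \sum_(p <- weights h T | k <= p.1) p.2 = Num.max h k - k.
Proof.
move=> h0 kT k0; rewrite /weights big_map /=.
rewrite -[X in _ - X](max_r k0).
rewrite -(@sum_cells _ h T (fun a b => Num.max b k - Num.max a k)); last first.
  by move=> a c b _; lra.
rewrite big_mkcond /= big_seq [RHS]big_seq; apply: eq_bigr => J Il.
have [_ I12 _] := cells_wf h0 Il.
have := cells_nosplit kT Il; case: (leP k J.1) => [kI|kI] /=; rewrite ?ltNge.
  by rewrite !max_l//; lra.
by rewrite negbK => ?; rewrite !max_r//; lra.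
Qed.

End OneSite.

(** * Lebesgue volumes as finite sums *)

Lemma measure_finite_partition d (T : measurableType d) (R : realType)
    (mu : {measure set T -> \bar R}) (J : finType) (F : J -> set T) (A : set T) :
  (forall i, measurable (F i)) -> trivIset setT F -> A = \bigcup_i F i ->
  mu A = (\sum_i mu (F i))%E.
Proof.
move=> mF tF ->; rewrite measure_fin_bigcup//; last first.
  by apply: sub_finite_set (@finite_finpred J _ predT) => i.
rewrite (fsbigE (index_enum J)) ?index_enum_uniq//; last first.
  by move=> i _; rewrite mem_index_enum.
by apply: eq_bigl => i; rewrite in_setT.
Qed.

Section Place.
Variables (R : realType) (S : choiceType).
Implicit Types (s : seq S) (eta : S -> R).

Definition place n s (t : n.-tuple (measurableTypeR R)) : S -> R :=
  fun x => nth 0 (t : seq R) (index x s).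

Lemma place_cons n x s a (t : n.-tuple (measurableTypeR R)) :
  place (x :: s) [tuple of a :: t] = upd (place s t) x a.
Proof. by apply/funext => y; rewrite /place /upd /= eq_sym; case: eqP. Qed.

Definition same_cell (C : seq (R * R)) s eta eta' :=
  (forall x, x \in s -> exists2 J, J \in C & inside J (eta x) && inside J (eta' x)) /\
  (forall x, x \notin s -> eta x = eta' x).

(** The event A sees the heights on s only through the cells they lie in. *)
Definition adapted C s (A : (S -> R) -> bool) :=
  forall eta eta', same_cell C s eta eta' -> A eta = A eta'.

Lemma adapted_upd C x s A J : J \in C -> J.1 < J.2 -> adapted C (x :: s) A ->
  adapted C s (fun eta => A (upd eta x J.1)).
Proof.
move=> IC I12 adA eta eta' [same eq]; apply: adA; split => y.
  rewrite /upd inE; case: eqP => /= [_ _|_]; last exact: same.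
  by exists J => //; rewrite /inside lexx I12.
by rewrite /upd inE; case: eqP => //= _; exact: eq.
Qed.

Variables (h : R) (T : seq R).
Hypothesis h0 : 0 < h.
Local Notation C := (cells h T).

Lemma same_cell_floor n s x a (t : n.-tuple (measurableTypeR R)) J :
  size s = n -> (forall i, 0 <= (tnth t i : R) < h) -> J \in C -> inside J a ->
  same_cell C (x :: s) (upd (place s t) x a) (upd (place s t) x J.1).
Proof.
move=> sn t0h JC aJ; split=> y; rewrite inE /upd; case: eqP => //= [_ _|_ ys].
  by exists J => //; rewrite aJ /inside lexx; have [] := cells_wf h0 JC.
have iy : (index y s < n)%N by rewrite -sn index_mem.
have /(cells_cover T)[K KC yK] := t0h (Ordinal iy).
by exists K => //; rewrite andbb; move: yK; rewrite (tnth_nth 0).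
Qed.

(** Cut the first coordinate along the cells: the event becomes a finite
    disjoint union of rectangles, and the left end point of a cell stands for
    all its points. *)
Lemma lebesgue_tuple_cells n s (A : (S -> R) -> bool) : size s = n ->
  adapted C s A ->
  let B := [set t : n.-tuple (measurableTypeR R) |
    (forall i, 0 <= (tnth t i : R) < h) /\ A (place s t)] in
  measurable B /\
  lebesgue_tuple R n B = (integ_seq (weights h T) s (fun eta => (A eta)%:R))%:E.
Proof.
elim: n s A => [|n IH] [|x s] A //= sn adA.
  have place0 (t : 0.-tuple (measurableTypeR R)) : place [::] t = fun=> 0.
    by apply/funext => y; rewrite /place nth_default// size_tuple.
  have -> : [set t : 0.-tuple (measurableTypeR R) |
      (forall i, 0 <= (tnth t i : R) < h) /\ A (place [::] t)] =
      if A (fun=> 0) then setT else set0.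
    apply/seteqP; split=> t /=; rewrite place0; first by move=> [_ ->].
    by case: ifP => // _ _; split=> // -[].
  case: ifP => A0; split => //=; first by rewrite diracT.
  by rewrite dirac0.
case: sn => sn.
pose I_ (i : 'I_(size C)) := nth (0, 0) C i.
have IC i : I_ i \in C by exact: mem_nth.
have I12 i : (I_ i).1 < (I_ i).2 by have [] := cells_wf h0 (IC i).
pose A_ i := fun eta => A (upd eta x (I_ i).1).
have adA_ i : adapted C s (A_ i) by apply: adapted_upd.
pose B_ i := [set t : n.-tuple (measurableTypeR R) |
    (forall i, 0 <= (tnth t i : R) < h) /\ A_ i (place s t)].
have mB i : measurable (B_ i) by have [] := IH s (A_ i) sn (adA_ i).
have BE i : lebesgue_tuple R n (B_ i) =
    (integ_seq (weights h T) s (fun eta => (A_ i eta)%:R))%:E.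
  by have [] := IH s (A_ i) sn (adA_ i).
pose F i : set (measurableTypeR R * n.-tuple (measurableTypeR R)) :=
  [set` `[(I_ i).1, (I_ i).2[ ] `*` B_ i.
have mF i : measurable (F i) by apply: measurableX => //; exact: mB.
have FP a (t : n.-tuple (measurableTypeR R)) :
    ((forall i, 0 <= (tnth [tuple of a :: t] i : R) < h) /\
      A (place (x :: s) [tuple of a :: t])) <-> (\bigcup_i F i) (a, t).
  split.
    move=> [box At].
    have a0h : 0 <= a < h by have := box ord0.
    have t0h i : 0 <= (tnth t i : R) < h by have := box (lift ord0 i); rewrite tnthS.
    have [J IinC aI] := cells_cover T a0h.
    have iC : (index J C < size C)%N by rewrite index_mem.
    exists (Ordinal iC) => //; split => /=; first by rewrite in_itv /I_ /= nth_index.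
    split=> //; rewrite /A_ /I_ /= nth_index//.
    by rewrite -(adA _ _ (same_cell_floor x sn t0h IinC aI)) -place_cons.
  move=> [i _ [/=]]; rewrite in_itv /= => aI [t0h At].
  have [Ia _ Ib] := cells_wf h0 (IC i).
  split.
    move=> j; have [k ->|->] := unliftP ord0 j; first by rewrite tnthS.
    by rewrite tnth0; move: aI => /andP[? ?]; apply/andP; split; lra.
  move: At; rewrite /A_ -(adA _ _ (same_cell_floor x sn t0h (IC i) aI)).
  by rewrite -place_cons.
split.
  pose hd (t : n.+1.-tuple (measurableTypeR R)) : measurableTypeR R * n.-tuple (measurableTypeR R) :=
    (thead t, [tuple of behead t]).
  have mhd : measurable_fun setT hd.
    by apply: measurable_fun_pair; [exact: measurable_tnth|exact: measurable_behead].
  rewrite [X in measurable X](_ : _ = setT `&` hd @^-1` \bigcup_i F i).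
    by apply: mhd => //; apply: fin_bigcup_measurable.
  rewrite setTI; apply/seteqP; split=> t; rewrite /= -FP.
    by rewrite /hd -tuple_eta.
  by rewrite /hd -tuple_eta.
rewrite /pushforward (@measure_finite_partition _ _ _ _ _ F)//; last 2 first.
- apply/trivIsetP => i j _ _ ij; rewrite -subset0 => -[a t] [[/= ai _] [/= aj _]].
  move: ai aj; rewrite !in_itv /= => ai aj.
  move/eqP: ij; apply; apply: (@cells_disjoint _ h T i j a) => //.
  by have [? _ ?] := cells_wf h0 (IC i); move: ai => /andP[? ?]; apply/andP; split; lra.
- by apply/seteqP; split=> -[a t]; rewrite /= FP.
rewrite /weights big_map (big_nth (0, 0)) big_mkord -sumEFin; apply: eq_bigr => i _.
rewrite EFinM -/(I_ i) -BE.
have mI : measurable ([set` `[(I_ i).1, (I_ i).2[ ] : set (measurableTypeR R)) by [].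
apply: (etrans (product_measure1E _ _ mI (mB i))).
congr (_ * _)%E.
transitivity (lebesgue_measure ([set` `[(I_ i).1, (I_ i).2[ ] : set R)) => //.
by rewrite lebesgue_measure_itv /= lte_fin I12.
Qed.

End Place.

(** * The lattice model *)
Section SiteMean.
Variables (R : realType) (S : choiceType) (e : rel S).
Hypothesis e_irr : irreflexive e.
Variables (N : nat) (h : R) (D : seq (R * R)).
Hypothesis degN : forall (W : {fset S}) y, (deg e W y <= N)%N.
Hypothesis Nh : N%:R < h.
Hypothesis D_ge0 : forall p, p \in D -> 0 <= p.2.
Hypothesis D_tail : forall k, (k <= N)%N ->
  \sum_(p <- D | k%:R <= p.1) p.2 = h - k%:R.

(** Dropping the constraint that x burns costs a factor [ratio], which is at
    most 1 / (h - N). *)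
Lemma mean_site_le (L : {fset S}) x (P : pred R) : x \in L ->
  mean e D L (fun eta => (P (eta x))%:R) <=
  (\sum_(p <- D | P p.1) p.2) / (h - N%:R).
Proof.
move=> xL; have ZL := total_weight_gt0 e_irr degN Nh D_ge0 D_tail L.
apply: le_trans (_ : (\sum_(p <- D | P p.1) p.2) * ratio e D L x <= _); last first.
  rewrite ler_wpM2l//; last exact: (ratio_le e_irr degN Nh D_ge0 D_tail).
  by rewrite big_seq_cond sumr_ge0// => p /andP[/D_ge0].
rewrite /mean /ratio mulrA ler_wpM2r ?invr_ge0 ?(ltW ZL)//.
rewrite (integ_D1 _ _ xL) [in leRHS]big_mkcond big_distrl /= big_seq [leRHS]big_seq.
apply: ler_sum => p pD.
apply: le_trans (_ : p.2 * integ D (L `\ x)%fset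
  (fun eta => (P p.1)%:R * (burnable e (L `\ x)%fset eta)%:R) <= _).
  apply: ler_wpM2l; first exact: D_ge0.
  apply: ler_integ_seq => // eta; rewrite /upd eqxx ler_wpM2l// ler_nat.
  rewrite (burnableD1 e_irr _ xL).
  have -> : burnable e (L `\ x)%fset (upd eta x p.1) = burnable e (L `\ x)%fset eta.
    rewrite /burnable (@core_local _ _ _ _ _ _ eta)// => y.
    by rewrite !inE /upd => /andP[/negPf ->].
  by case: (burnable _ _ _) => //=; exact: leq_b1.
by rewrite /integ integ_seqZ; case: (P p.1); rewrite ?mul1r ?mul0r ?mulr0.
Qed.

End SiteMean.

Section Lattice.
Variables (R : realType) (d : nat).
Implicit Types (L : {fset site d}).

Lemma adj_irr : irreflexive (@adj R d).
Proof.
move=> x; rewrite /adj /Defs.edist big1; first by rewrite sqrtr0 eq_sym oner_eq0.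
by move=> i _; rewrite subrr expr0n.
Qed.

Lemma deg_adj_le (W : {fset site d}) y : (deg (@adj R d) W y <= 2 * d)%N.
Proof. by apply: (@nbrs_in_le R d _ id). Qed.

Definition lattice_nbrs (y : site d) : {fset site d} :=
  [fset (y + (-1) ^+ p.2 *: delta_mx 0 p.1)%R | p : 'I_d * bool in {: 'I_d * bool}]%fset.

Lemma lattice_nbrsP (y z : site d) : adj R z y -> z \in lattice_nbrs y.
Proof. by move=> /adj_unit_vector[p ->]; apply/imfsetP; exists p. Qed.

Lemma nbrs_in_image L (W : {fset L}) (y : L) :
  nbrs_in R (fun x : L => val x) W y = deg (@adj R d) (val @` W)%fset (val y).
Proof.
rewrite /nbrs_in /deg; set A := [fset z in W | _]%fset.
have <- : #|` (val @` A)%fset| = #|` A| by rewrite card_imfset//; exact: val_inj.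
congr (#|` _|); apply/fsetP => z; apply/imfsetP/idP => [[u /=]|].
  rewrite !inE /= => /andP[uW uy] ->; rewrite uy andbT.
  by apply/imfsetP; exists u.
rewrite !inE /= => /andP[/imfsetP[u /= uW ->] uy].
by exists u; rewrite // !inE /= uW.
Qed.

Lemma extend0_val L (eta : config L R) (u : L) : extend0 L eta (val u) = eta u.
Proof. by rewrite /extend0 valK. Qed.

Lemma extend0_out L (eta : config L R) x : x \notin L -> extend0 L eta x = 0.
Proof. by move=> xL; rewrite /extend0 insubN. Qed.

Lemma burnable_extend0 L (eta : config L R) :
  burnable (@adj R d) L (extend0 L eta) <->
  ~ exists W, forbidden (fun x : L => val x) eta W.
Proof.
split.
  move=> /eqP bL [W [/fset0Pn[u uW] forb]].
  have stW : stuck (@adj R d) fset0 (extend0 L eta) (val @` W)%fset.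
    apply/stuckP => _ /imfsetP[y /= yW ->].
    by rewrite extend0_val fsetU0 -nbrs_in_image forb.
  have WL : ((val @` W)%fset `<=` L)%fset.
    by apply/fsubsetP => _ /imfsetP[y /= _ ->]; exact: valP.
  have uU : val u \in (val @` W)%fset by apply/imfsetP; exists u.
  by have := fsubsetP (core_max WL stW) _ uU; rewrite bL inE.
move=> nforb; rewrite /burnable; apply/negPn/negP => U0; apply: nforb.
set U := core _ _ _ _ in U0.
have UL : (U `<=` L)%fset := core_sub _ _ _ _.
pose W := [fset u : L | val u \in U]%fset.
have WU : (val @` W)%fset = U.
  apply/fsetP => z; apply/imfsetP/idP => [[u /=]|zU].
    by rewrite !inE /= => uU ->.
  by exists [` fsubsetP UL _ zU]%fset => //; rewrite !inE.
exists W; split.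
  move/fset0Pn: U0 => [z]; rewrite -WU => /imfsetP[u /= uW _].
  by apply/fset0Pn; exists u.
move=> y; rewrite !inE /= => yU; rewrite nbrs_in_image WU -extend0_val.
by have := core_lt yU; rewrite fsetU0.
Qed.

Variable (h : R) (T : seq R).
Hypothesis h0 : 0 < h.
Local Notation C := (cells h T).

Lemma vol_cells L (A : (site d -> R) -> bool) : adapted C L A ->
  vol [set eta : config L R | (forall u, 0 <= eta u < h) /\ A (extend0 L eta)] =
  (integ (weights h T) L (fun eta => (A eta)%:R))%:E.
Proof.
move=> adA; pose s := [seq val u | u <- enum {: L}].
have ss : size s = #|{: L}| by rewrite size_map -cardE.
have mems : s =i L.
  move=> x; apply/mapP/idP => [[u _ ->]|xL]; first exact: valP.
  by exists [` xL]%fset => //; rewrite mem_enum.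
have adAs : adapted C s A.
  move=> eta eta' [same eq]; apply: adA; split=> x.
    by move=> xL; apply: same; rewrite mems.
  by move=> xL; apply: eq; rewrite mems.
have us : uniq s by rewrite map_inj_uniq ?enum_uniq//; exact: val_inj.
have -> : integ (weights h T) L (fun eta => (A eta)%:R) =
          integ_seq (weights h T) s (fun eta => (A eta)%:R).
  by apply: integ_seq_perm; rewrite ?fset_uniq//; apply: uniq_perm; rewrite ?fset_uniq.
have [_ <-] := lebesgue_tuple_cells h0 ss adAs.
rewrite /vol /pushforward; congr (lebesgue_tuple _ _ _).
have ext t : extend0 L (@config_of_tuple R L t) = place s t.
  apply/funext => x; rewrite /place; have [xL|xL] := boolP (x \in L).
    pose u := [` xL]%fset; rewrite -[x]/(val u) extend0_val /config_of_tuple.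
    rewrite (tnth_nth 0) /s index_map; last exact: val_inj.
    congr nth; rewrite -[in RHS](nth_enum_rank u u) index_uniq ?enum_uniq//.
    by rewrite -cardE.
  rewrite extend0_out// nth_default// size_tuple -ss leqNgt index_mem.
  by rewrite mems.
apply/seteqP; split=> t /=; rewrite ext => -[box At]; split=> //.
  by move=> i; have := box (enum_val i); rewrite /config_of_tuple enum_valK.
by move=> u; exact: box.
Qed.

End Lattice.

Section MeanExt.
Variables (R : realType) (d : nat) (gamma : R).
Hypothesis gamma0 : 0 < gamma.
Implicit Types (L : {fset site d}) (T : seq R).

Definition hmax : R := (2 * d)%:R + gamma.
Local Notation h := hmax.

Lemma hmax_gt0 : 0 < h. Proof. by rewrite ltr_wpDl. Qed.

Lemma deg_hmax : (2 * d)%:R < h. Proof. by rewrite ltrDl. Qed.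

(** Cutting at the integers 0, ..., 2d as well makes burning an event of the
    cells. *)
Definition levels T : seq R := T ++ [seq k%:R | k <- iota 0 (2 * d).+1].

Definition site_weights T := weights h (levels T).

Lemma site_weights_ge0 T p : p \in site_weights T -> 0 <= p.2.
Proof. exact: weights_ge0 hmax_gt0. Qed.

Lemma nat_levels T k : (k <= 2 * d)%N -> k%:R \in levels T.
Proof.
move=> kd; rewrite mem_cat; apply/orP; right.
by apply/mapP; exists k; rewrite // mem_iota.
Qed.

Lemma site_weights_tail T k : (k <= 2 * d)%N ->
  \sum_(p <- site_weights T | k%:R <= p.1) p.2 = h - k%:R.
Proof.
move=> kd; rewrite (weights_tail hmax_gt0 (nat_levels T kd))// max_l//.
by rewrite (le_trans _ (ltW deg_hmax))// ler_nat.
Qed.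

Lemma same_cell_le T L eta eta' x (c : R) : c \in levels T ->
  same_cell (cells h (levels T)) L eta eta' -> (c <= eta x) = (c <= eta' x).
Proof.
move=> cT [same eq]; have [xL|/eq -> //] := boolP (x \in L).
have [J JC /andP[/andP[a b] /andP[a' b']]] := same x xL.
have := cells_nosplit cT JC; rewrite negb_and -!leNgt.
by case: (leP c (eta x)) (leP c (eta' x)) => ? [] ? //; case/orP => ?; lra.
Qed.

Lemma burnable_adapted T L (A : (site d -> R) -> bool) :
  adapted (cells h (levels T)) L A ->
  adapted (cells h (levels T)) L (fun eta => A eta && burnable (@adj R d) L eta).
Proof.
move=> adA eta eta' same; rewrite (adA _ _ same); congr andb.
rewrite /burnable /core; congr (_ == _); rewrite big_seq_cond [RHS]big_seq_cond.
apply: eq_bigl => U; congr andb; apply: eq_in_all => y _.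
rewrite !ltNge; congr negb; apply: same_cell_le same.
exact/nat_levels/deg_adj_le.
Qed.

(** The finite-volume measure of an event that only depends on cells is the
    discrete mean, so the results on local means apply to it. *)
Lemma m_ext_mean T L (A : (site d -> R) -> bool) :
  adapted (cells h (levels T)) L A ->
  m_ext gamma L [set eta | A eta] =
  (mean (@adj R d) (site_weights T) L (fun eta => (A eta)%:R))%:E.
Proof.
move=> adA; rewrite /m_ext /pushforward m_finE//.
have volE (B : (site d -> R) -> bool) : adapted (cells h (levels T)) L B ->
    vol ((extend0 L @^-1` [set eta | B eta]) `&` Rec_fin L gamma) =
    (integ (site_weights T) L (fun eta => (B eta)%:R * (burnable (@adj R d) L eta)%:R))%:E.
  move=> adB; transitivity (vol [set eta : config L R | (forall u, 0 <= eta u < h) /\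
       (B (extend0 L eta) && burnable (@adj R d) L (extend0 L eta))]).
    congr (vol _); apply/seteqP; split=> eta /=.
      by move=> [Beta [st /burnable_extend0 bL]]; split=> //; rewrite Beta.
    by move=> [st /andP[Beta /burnable_extend0 bL]].
  rewrite (vol_cells hmax_gt0 (burnable_adapted adB)); congr _%:E.
  by apply: integ_seq_ext => eta; rewrite -natrM mulnb.
have -> : vol (Rec_fin L gamma) = (total_weight (@adj R d) (site_weights T) L)%:E.
  have := @volE (fun=> true) (fun _ _ _ => erefl).
  rewrite (_ : [set _ | _] = setT) ?preimage_setT ?setTI.
    by move=> ->; congr _%:E; apply: integ_seq_ext => eta; rewrite mul1r.
  by apply/seteqP.
by rewrite volE.
Qed.

End MeanExt.

(** * Coding configurations by bits *)

Lemma mkseq_measurable dT (T : measurableType dT) (b : T -> nat -> bool) :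
  (forall i, measurable [set t | b t i]) ->
  forall n (Q : pred (seq bool)), measurable [set t | Q (mkseq (b t) n)].
Proof.
move=> mb; elim=> [|n IH] Q.
  rewrite (_ : [set _ | _] = if Q [::] then setT else set0); first by case: ifP.
  by apply/seteqP; split=> t /=; case: ifP.
rewrite (_ : [set _ | _] =
    ([set t | b t n] `&` [set t | Q (rcons (mkseq (b t) n) true)]) `|`
    (~` [set t | b t n] `&` [set t | Q (rcons (mkseq (b t) n) false)])).
  apply: measurableU; apply: measurableI.
  - exact: mb.
  - exact: (IH (fun w => Q (rcons w true))).
  - exact/measurableC/mb.
  - exact: (IH (fun w => Q (rcons w false))).
apply/seteqP; split=> t /=; rewrite mkseqS.
  by case: (b t n); [left|right].
by case=> -[]; case: (b t n).
Qed.

Section Bits.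
Variables (R : realType) (d : nat).
Implicit Types (eta : config (site d) R) (Q : pred (seq bool)).

(** An enumeration, with repetitions, of all pairs of a site and a rational
    level. *)
Definition threshold (i : nat) : site d * rat := odflt (0, 0) (choice.unpickle i).

Lemma threshold_pickle (z : site d * rat) : threshold (choice.pickle z) = z.
Proof. by rewrite /threshold choice.pickleK. Qed.

Definition bit eta (i : nat) : bool :=
  ratr (threshold i).2 <= eta (threshold i).1.

Definition word n eta : seq bool := mkseq (bit eta) n.

Definition cyl n Q : set (config (site d) R) := [set eta | Q (word n eta)].

Lemma size_word n eta : size (word n eta) = n. Proof. exact: size_mkseq. Qed.

Lemma nth_word n eta i : (i < n)%N -> nth false (word n eta) i = bit eta i.
Proof. exact: nth_mkseq. Qed.

Lemma bit_measurable i : measurable [set eta | bit eta i].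
Proof.
rewrite (_ : [set _ | _] = ~` [set eta | eta (threshold i).1 < ratr (threshold i).2]).
  by apply: measurableC; exact: config_lt_measurable.
by apply/seteqP; split=> eta /=; rewrite /bit leNgt => /negP.
Qed.

Lemma cyl_measurable n Q : measurable (cyl n Q).
Proof. exact: mkseq_measurable bit_measurable n Q. Qed.

End Bits.

Section CylinderLimits.
Variables (R : realType) (d : nat) (gamma : R).
Hypothesis gamma0 : 0 < gamma.
Local Notation h := (hmax d gamma).
Implicit Types (L : {fset site d}) (Q : pred (seq bool)).

#[local] Existing Instance totally_filter.

Definition mass L (A : set (config (site d) R)) : R := fine (m_ext gamma L A).

Lemma massE L A : measurable A -> (mass L A)%:E = m_ext gamma L A.
Proof. by move=> mA; rewrite /mass fineK// fin_num_measure. Qed.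

(** Cut each height at the finitely many levels met by the first n bits. *)
Lemma cyl_cvg n Q : cvg ((fun L => mass L (cyl n Q)) @ totally).
Proof.
pose T : seq R := [seq ratr (threshold d i).2 | i <- iota 0 n].
pose A (eta : site d -> R) := Q (word n (eta : config (site d) R)).
have adA L : adapted (cells h (levels d T)) L A.
  move=> eta eta' same; rewrite /A; congr Q.
  apply/eq_in_map => i i_n.
  apply: (same_cell_le _ _ same); rewrite mem_cat; apply/orP; left.
  by apply/mapP; exists i.
have massA L : mass L (cyl n Q) =
    mean (@adj R d) (site_weights d gamma T) L (fun eta => (A eta)%:R).
  by rewrite /mass (m_ext_mean gamma0 (adA L)).
apply: (@cvg_totally_eq _ _ _ _ fset0 (fun L _ => massA L)).
pose V := [fset (threshold d i).1 | i in iota 0 n]%fset.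
apply: (@local_cvg R (site d) (@adj R d) (@adj_irr R d) _ h _ (@lattice_nbrs d)
  (@deg_adj_le R d) (deg_hmax d gamma0)
  (@site_weights_ge0 R d gamma gamma0 T) (@site_weights_tail R d gamma gamma0 T)
  (@lattice_nbrsP R d) V _ 1).
  move=> eta eta' ee; rewrite /A; congr (Q _)%:R.
  apply/eq_in_map => i i_n; rewrite /bit ee//.
  by apply/imfsetP; exists i.
by move=> eta; rewrite ger0_norm// lern1 leq_b1.
Qed.

(** Absolute continuity of the one-site law, uniformly in the volume. *)
Lemma mass_strip_le L x (s t : rat) : x \in L -> (0 <= s)%R -> (s <= t)%R ->
  mass L [set eta | ratr s <= eta x < ratr t] <= (ratr t - ratr s) / gamma.
Proof.
move=> xL s0 st; pose T : seq R := [:: ratr s; ratr t].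
pose P (a : R) := ratr s <= a < ratr t.
pose A (eta : site d -> R) := P (eta x).
have sT : ratr s \in levels d T by rewrite mem_cat inE eqxx.
have tT : ratr t \in levels d T by rewrite mem_cat !inE eqxx orbT.
have adA : adapted (cells h (levels d T)) L A.
  move=> eta eta' same; rewrite /A /P.
  by rewrite (same_cell_le x sT same) !ltNge (same_cell_le x tT same).
rewrite /mass (m_ext_mean gamma0 adA) /=.
have := @mean_site_le R (site d) (@adj R d) (@adj_irr R d) _ h _
  (@deg_adj_le R d) (deg_hmax d gamma0)
  (@site_weights_ge0 R d gamma gamma0 T) (@site_weights_tail R d gamma gamma0 T)
  L x P xL.
rewrite (_ : h - _ = gamma); last by rewrite /hmax addrC addKr.
move=> H; apply: le_trans H _.
apply: ler_wpM2r; first by rewrite invr_ge0 ltW.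
have rs0 : 0 <= ratr s :> R by rewrite ler0q.
have rst : ratr s <= ratr t :> R by rewrite ler_rat.
have : \sum_(p <- site_weights d gamma T | P p.1) p.2 =
   \sum_(p <- site_weights d gamma T | ratr s <= p.1) p.2 -
   \sum_(p <- site_weights d gamma T | ratr t <= p.1) p.2.
  rewrite [X in _ = X - _]big_mkcond [X in _ = _ - X]big_mkcond -sumrB big_mkcond /=.
  apply: eq_bigr => p _; rewrite /P ltNge; case: (leP (ratr t) p.1) => tp.
    by rewrite andbF (le_trans rst tp) subrr.
  by rewrite andbT subr0.
rewrite !(weights_tail (hmax_gt0 d gamma0))//; last exact: le_trans rst.
have : Num.max h (ratr s) <= Num.max h (ratr t).
  by rewrite ge_max !le_max lexx rst orbT.
by move=> + ->; lra.
Qed.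

Lemma mass_Omega L : m_ext gamma L (Omega d gamma) = 1%E.
Proof.
transitivity (m_fin gamma L setT); last exact: probability_setT.
rewrite /m_ext /pushforward !m_finE//; congr (vol _ * _)%E; rewrite setTI; apply/setIidPr => eta [st _] x /=.
have [xL|xL] := boolP (x \in L).
  by rewrite -[x]/(val [` xL]%fset) extend0_val; exact: st.
by rewrite extend0_out// lexx (hmax_gt0 d gamma0).
Qed.

(** The set W would be stuck in L. *)
Lemma mass_forbidden L W : (W `<=` L)%fset -> W != fset0 ->
  mass L [set eta | forall y, y \in W -> eta y < (nbrs_in R id W y)%:R] = 0.
Proof.
move=> WL W0; rewrite /mass /m_ext /pushforward m_finE//.
rewrite (_ : _ `&` _ = set0) ?measure0 ?mul0e//.
rewrite -subset0 => eta [/= forb [_]] /burnable_extend0 /eqP bL.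
have : (W `<=` core (@adj R d) L fset0 (extend0 L eta))%fset.
  by apply: core_max => //; apply/stuckP => y yW; rewrite fsetU0; exact: forb.
by rewrite bL fsubset0; apply/negP.
Qed.

End CylinderLimits.

Section CylinderBase.
Variables (R : realType) (d : nat).

Lemma pointwise_cvg (xi : nat -> config (site d) R) (eta : config (site d) R) :
  (forall x, xi n x @[n --> \oo] --> eta x) -> xi @ \oo --> eta.
Proof.
move=> cv; apply/cvg_sup => x; apply/cvg_image.
  by rewrite eqEsubset; split=> v // _; exists (fun=> v).
move=> A /(cv x); rewrite /nbhs /= => H.
exists ((fun eta : config (site d) R => eta x) @^-1` A) => //=.
by rewrite image_preimage// eqEsubset; split=> v // _; exists (fun=> v).
Qed.

(** Long codes determine small neighbourhoods: a sequence of configurations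
    sharing longer and longer codes with eta converges to eta at each site,
    since two rationals bracket the height there. *)
Lemma nbhs_word (U : set (config (site d) R)) eta : nbhs eta U ->
  exists n, forall eta', word n eta' = word n eta -> U eta'.
Proof.
move=> nU; apply: contrapT => noN.
have /choice[xi xiP] : forall n, exists eta', word n eta' = word n eta /\ ~ U eta'.
  move=> n; apply: contrapT => H; apply: noN; exists n => eta' E.
  by apply: contrapT => nU'; apply: H; exists eta'.
have : xi @ \oo --> eta.
  apply: pointwise_cvg => x; apply/cvgrPdist_lt => eps eps0.
  have [s] : exists s : rat, ratr s \in `](eta x - eps), (eta x)[.
    by apply: rat_in_itvoo; rewrite ltrBlDr ltrDl.
  have [t] : exists t : rat, ratr t \in `](eta x), (eta x + eps)[.
    by apply: rat_in_itvoo; rewrite ltrDl.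
  rewrite !in_itv /= => /andP[t1 t2] /andP[s1 s2].
  near=> n.
  have bE (q : rat) : (choice.pickle (x, q) < n)%N ->
      (ratr q <= xi n x) = (ratr q <= eta x).
    move=> qn; have [wE _] := xiP n.
    have := congr1 (fun w => nth false w (choice.pickle (x, q))) wE.
    by rewrite !nth_word// /bit threshold_pickle.
  have sE : ratr s <= xi n x by rewrite bE ?(ltW s2)//; near: n; exact: nbhs_infty_gt.
  have tE : xi n x < ratr t.
    by rewrite ltNge bE -?ltNge//; near: n; exact: nbhs_infty_gt.
  by rewrite distrC ltr_norml; apply/andP; split; lra.
move=> /(_ _ nU) [n _ /(_ n (leqnn n))] /=.
by have [_] := xiP n.
Unshelve. all: by end_near. Qed.

(** By [nbhs_word] an open set is a countable union of cylinders. *)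
Lemma config_coord_measurable dT (T : measurableType dT) (f : T -> config (site d) R) :
  (forall x (t : rat), measurable [set w | ratr t <= f w x]) ->
  measurable_fun setT f.
Proof.
move=> mf; apply: (measurability (@open (config (site d) R))) => //.
move=> _ [U oU <-]; rewrite setTI.
rewrite (_ : f @^-1` U = \bigcup_(nw in
    [set nw : nat * seq bool | cyl (R := R) nw.1 (pred1 nw.2) `<=` U])
    f @^-1` cyl (R := R) nw.1 (pred1 nw.2)).
  rewrite bigcup_mkcond; apply: countable_bigcupT_measurable => // -[n w].
  case: ifPn => // _; apply: (mkseq_measurable (b := fun w => bit (f w))) => i.
  exact: mf.
apply/seteqP; split=> [w Uw|w [[n v]] /=]; last by move=> sub /sub.
have [n Hn] := nbhs_word (open_nbhs_nbhs (conj oU Uw)).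
exists (n, word n (f w)); last by rewrite /cyl /=.
by move=> eta /= /eqP; exact: Hn.
Qed.

End CylinderBase.

(** * A random configuration from a uniform random number *)

Section Words.
Variables (dT : measure_display) (T : measurableType dT) (R : realType).
Variable (mu : {measure set T -> \bar R}).

Lemma measure_words n (W : T -> seq bool) (Q : pred (seq bool)) :
  (forall t, size (W t) = n) -> (forall w, measurable [set t | W t = w]) ->
  mu [set t | Q (W t)] =
  (\sum_(w : n.-tuple bool | Q w) mu [set t | W t = w])%E.
Proof.
move=> sW mW; pose F (w : n.-tuple bool) := if Q w then [set t | W t = w] else set0.
rewrite (@measure_finite_partition _ _ _ mu _ F).
- rewrite [RHS]big_mkcond; apply: eq_bigr => w _; rewrite /F.
  by case: ifP; rewrite ?measure0.
- by move=> w; rewrite /F; case: ifP.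
- apply/trivIsetP => v w _ _ vw; rewrite -subset0 => t []; rewrite /F.
  case: ifP => // _; case: ifP => // _ /= tv tw; move/eqP: vw; apply.
  by apply: val_inj; rewrite /= -tv -tw.
apply/seteqP; split=> [t /= QW|t [w _]]; last by rewrite /F; case: ifP => // Qw /= ->.
exists (Tuple (introT eqP (sW t))) => //.
by rewrite /F /= QW.
Qed.

End Words.

Section Decoding.
Variables (R : realType) (p : seq bool -> R).
Hypothesis p_ge0 : forall w, 0 <= p w.
Hypothesis p_nil : p [::] = 1.
Hypothesis p_rcons : forall w, p w = p (rcons w false) + p (rcons w true).

(** The words with a common prefix w are laid out in an interval of length p w
    starting here, those continued by false first. *)
Definition left_end (w : seq bool) : R :=
  \sum_(i < size w) (nth false w i)%:R * p (rcons (take i w) false).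

Lemma left_end_rcons w b :
  left_end (rcons w b) = left_end w + b%:R * p (rcons w false).
Proof.
rewrite /left_end size_rcons big_ord_recr /= nth_rcons ltnn eqxx.
rewrite -cats1 take_size_cat//; congr (_ + _); apply: eq_bigr => i _.
by rewrite nth_cat ltn_ord takel_cat// ltnW.
Qed.

Fixpoint decode n (omega : R) : seq bool :=
  if n is m.+1 then
    let w := decode m omega in
    rcons w (left_end w + p (rcons w false) <= omega)
  else [::].

Definition decode_bit omega i : bool :=
  left_end (decode i omega) + p (rcons (decode i omega) false) <= omega.

Lemma decodeE n omega : decode n omega = mkseq (decode_bit omega) n.
Proof. by elim: n => [//|n IH]; rewrite mkseqS -IH. Qed.

Lemma left_end_bounds w : 0 <= left_end w /\ left_end w + p w <= 1.
Proof.
elim/last_ind: w => [|w b [IH0 IH1]].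
  by rewrite /left_end big_ord0 add0r p_nil.
rewrite left_end_rcons; have := p_rcons w.
have := p_ge0 (rcons w false); have := p_ge0 (rcons w true).
by case: b => /=; rewrite ?mul1r ?mul0r => ? ? ?; split; lra.
Qed.

(** The numbers decoded as w form the interval allotted to w. *)
Lemma decode_fibre w omega : 0 <= omega < 1 ->
  (decode (size w) omega == w) = (left_end w <= omega < left_end w + p w).
Proof.
move=> om; elim/last_ind: w => [|w b IH].
  by rewrite /left_end big_ord0 p_nil add0r om.
rewrite size_rcons /= eqseq_rcons left_end_rcons.
have := p_rcons w; have := p_ge0 (rcons w false); have := p_ge0 (rcons w true).
move=> p1 p0 ps; move: IH; case: eqVneq => [->|_] /esym IH; last first.
  apply/esym/negbTE; apply: contraFN IH => /andP[].
  by case: b; rewrite ?mul1r ?mul0r => *; apply/andP; split; lra.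
move/andP: IH => [le1 lt2]; case: b; rewrite ?mul1r ?mul0r ?addr0.
  by rewrite eqb_id; apply/idP/andP => [?|[]//]; split; lra.
by rewrite eqbF_neg -ltNge; apply/idP/andP => [?|[]//]; split; lra.
Qed.

Lemma measurable_ge (c : R) : measurable [set omega : measurableTypeR R | c <= omega].
Proof.
rewrite (_ : [set _ | _] = [set` `[c, +oo[ ]) //.
by apply/seteqP; split=> omega /=; rewrite in_itv /= andbT.
Qed.

Lemma decode_eq_measurable n w :
  measurable [set omega : measurableTypeR R | decode n omega = w].
Proof.
elim: n w => [|n IH] w.
  have [->|wN] := eqVneq w [::].
    by rewrite (_ : [set _ | _] = setT) //; apply/seteqP.
  rewrite (_ : [set _ | _] = set0) //; apply/seteqP; split=> // omega /= wE.
  by rewrite -wE in wN.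
case/lastP: w => [|w b].
  rewrite (_ : [set _ | _] = set0) //; apply/seteqP; split=> // omega /=.
  by move/(congr1 size); rewrite size_rcons.
pose c := left_end w + p (rcons w false).
have mc : measurable [set omega : measurableTypeR R | (c <= omega) = b].
  case: b; first exact: (measurable_ge c).
  rewrite (_ : [set _ | _] = ~` [set omega : measurableTypeR R | c <= omega]).
    by apply: measurableC; exact: measurable_ge.
  by apply/seteqP; split=> omega /= => [->//|/negP/negPf].
rewrite (_ : [set _ | _] = [set omega : measurableTypeR R | decode n omega = w] `&`
    [set omega : measurableTypeR R | (c <= omega) = b]).
  exact: measurableI.
apply/seteqP; split=> omega /=.
  by move=> /rcons_inj[wE bE]; split=> //; rewrite /c -wE.
by move=> [wE bE]; rewrite wE -/c bE.
Qed.

Lemma decode_bit_measurable i :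
  measurable [set omega : measurableTypeR R | decode_bit omega i].
Proof.
rewrite (_ : [set _ | _] = \bigcup_(w in [set w : i.+1.-tuple bool | nth false w i])
    [set omega : measurableTypeR R | decode i.+1 omega = w]).
  rewrite bigcup_mkcond; apply: countable_bigcupT_measurable => // w.
  by case: ifP => // _; exact: decode_eq_measurable.
have nthE omega : nth false (decode i.+1 omega) i = decode_bit omega i.
  by rewrite decodeE nth_mkseq.
have sd omega : size (decode i.+1 omega) == i.+1 by rewrite decodeE size_mkseq.
apply/seteqP; split=> [omega bi|omega [w wi wE]].
  by exists (Tuple (sd omega)); [rewrite /= -/(decode i.+1 omega) nthE|].
by rewrite /= -nthE wE.
Qed.

Definition unit_lebesgue : {measure set (measurableTypeR R) -> \bar R} :=
  mrestr (@lebesgue_measure R)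
    (measurable_itv `[0, 1[ : measurable ([set` `[0, 1[ ] : set (measurableTypeR R))).

Lemma decode_measure w :
  unit_lebesgue [set omega | decode (size w) omega = w] = (p w)%:E.
Proof.
have [l0 l1] := left_end_bounds w.
rewrite /unit_lebesgue /= /mrestr.
rewrite (_ : _ `&` _ = [set` `[left_end w, (left_end w + p w)[ ]); last first.
  apply/seteqP; split=> omega /=; rewrite !in_itv /=.
    by move=> [wE om]; rewrite -decode_fibre// wE.
  move=> om; have om1 : 0 <= omega < 1.
    by move/andP: om => [? ?]; apply/andP; split; lra.
  by split=> //; apply/eqP; rewrite decode_fibre.
rewrite lebesgue_measure_itv /= lte_fin ltrDl.
have := p_ge0 w; rewrite le_eqVlt => /orP[/eqP <-|->].
  by rewrite ltxx.
by rewrite -EFinB addrAC subrr add0r.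
Qed.

End Decoding.

Lemma negligible_countable_bigcup dT (T : measurableType dT) (R : realType)
    (mu : {measure set T -> \bar R}) (J : countType) (F : J -> set T) :
  (forall j, mu.-negligible (F j)) -> mu.-negligible (\bigcup_j F j).
Proof.
move=> nF; pose G n := if choice.unpickle n is Some j then F j else set0.
apply: (@negligibleS _ _ _ _ (\bigcup_n G n)).
  by move=> t [j _ Fj]; exists (choice.pickle j) => //; rewrite /G choice.pickleK.
apply: negligible_bigcup => n; rewrite /G; case: choice.unpickle => [j|].
  exact: nF.
exact: negligible_set0.
Qed.

(** * The limit measure *)
Section LimitMeasure.
Variables (R : realType) (d : nat) (gamma : R).
Hypothesis gamma0 : 0 < gamma.
Local Notation h := (hmax d gamma).
Local Notation mass := (mass gamma).
Implicit Types (L : {fset site d}) (Q : pred (seq bool)) (x : site d).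

#[local] Existing Instance totally_filter.

Definition lim_mass (A : set (config (site d) R)) : R :=
  lim ((fun L => mass L A) @ totally).

Lemma lim_mass_cvg n Q :
  (fun L => mass L (cyl n Q)) @ totally --> lim_mass (cyl n Q).
Proof. exact: cyl_cvg. Qed.

Lemma lim_mass_le n Q (L0 : {fset site d}) (c : R) :
  (forall L, (L0 `<=` L)%fset -> mass L (cyl n Q) <= c) -> lim_mass (cyl n Q) <= c.
Proof.
by move=> H; apply: limr_le; [exact: cyl_cvg|exact: near_totally H].
Qed.

Lemma mass_ge0 L A : 0 <= mass L A.
Proof. by rewrite /mass fine_ge0. Qed.

Lemma lim_mass_ge0 n Q : 0 <= lim_mass (cyl n Q).
Proof.
apply: limr_ge; first exact: cyl_cvg.
by apply: (@near_totally _ fset0) => L _; exact: mass_ge0.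
Qed.

Lemma cyl_sum (mu : probability (config (site d) R) R) n Q :
  fine (mu (cyl n Q)) =
  \sum_(w : n.-tuple bool | Q w) fine (mu (cyl n (pred1 (w : seq bool)))).
Proof.
apply: EFin_inj; rewrite fineK ?fin_num_measure//; last exact: cyl_measurable.
rewrite (@measure_words _ _ _ mu n (word n) Q).
- rewrite -sumEFin; apply: eq_bigr => w _.
  rewrite fineK ?fin_num_measure//; last exact: cyl_measurable.
  by congr (mu _); apply/seteqP; split=> eta /= /eqP.
- by move=> eta; exact: size_word.
move=> w; rewrite (_ : [set _ | _] = cyl n (pred1 w)); first exact: cyl_measurable.
by apply/seteqP; split=> eta /= /eqP.
Qed.

Lemma lim_mass_sum n Q : lim_mass (cyl n Q) =
  \sum_(w : n.-tuple bool | Q w) lim_mass (cyl n (pred1 (w : seq bool))).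
Proof.
apply: cvg_lim => //.
rewrite (_ : (fun L => mass L (cyl n Q)) = fun L =>
    \sum_(w : n.-tuple bool | Q w) mass L (cyl n (pred1 (w : seq bool)))).
  apply: cvg_big => [|w _]; last exact: lim_mass_cvg.
  exact: add_continuous.
by apply/funext => L; exact: cyl_sum.
Qed.

Definition word_mass (w : seq bool) : R := lim_mass (cyl (size w) (pred1 w)).

Lemma word_mass_ge0 w : 0 <= word_mass w.
Proof. exact: lim_mass_ge0. Qed.

Lemma word_mass_nil : word_mass [::] = 1.
Proof.
apply: cvg_lim => //; apply: cvg_near_cst; apply: (@near_totally _ fset0) => L _.
rewrite /mass (_ : cyl _ _ = setT) ?probability_setT//.
by apply/seteqP; split.
Qed.

Lemma word_mass_rcons w :
  word_mass w = word_mass (rcons w false) + word_mass (rcons w true).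
Proof.
apply: cvg_lim => //.
rewrite (_ : (fun L => _) = fun L => mass L (cyl (size (rcons w false)) (pred1 (rcons w false))) +
    mass L (cyl (size (rcons w true)) (pred1 (rcons w true)))).
  by apply: cvgD; exact: lim_mass_cvg.
apply/funext => L; apply: EFin_inj; rewrite EFinD !massE; try exact: cyl_measurable.
rewrite -measureU; try exact: cyl_measurable.
  congr (m_ext gamma L _); apply/seteqP; split=> eta; rewrite /cyl /= !size_rcons /word mkseqS.
    move=> /eqP ->; rewrite !eqseq_rcons eqxx /=.
    by case: (bit _ _); [right|left].
  by rewrite !eqseq_rcons => -[]/andP[].
rewrite -subset0 => eta []; rewrite /cyl /= !size_rcons => /eqP -> /eqP /rcons_inj[].
by [].
Qed.

Local Notation U := (unit_lebesgue R).
Local Notation dbit := (decode_bit word_mass).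
Local Notation dec := (decode word_mass).

(** The decoded bits of a uniform number have the limiting joint law. *)
Lemma decode_law n Q : U [set omega | Q (dec n omega)] = (lim_mass (cyl n Q))%:E.
Proof.
rewrite (@measure_words _ _ _ U n (dec n) Q).
- rewrite lim_mass_sum -sumEFin; apply: eq_bigr => w _.
  have := decode_measure word_mass_ge0 word_mass_nil word_mass_rcons w.
  by rewrite /word_mass size_tuple.
- by move=> omega; rewrite decodeE size_mkseq.
- by move=> w; exact: decode_eq_measurable.
Qed.

Definition two_bits i j a b : set (config (site d) R) :=
  [set eta | (bit eta i == a) && (bit eta j == b)].

Lemma two_bits_cyl i j a b : two_bits i j a b =
  cyl (maxn i j).+1 (fun w => (nth false w i == a) && (nth false w j == b)).
Proof.
apply/seteqP; split=> eta; rewrite /cyl /= !nth_word// ltnS; by rewrite ?leq_maxl ?leq_maxr.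
Qed.

Lemma decode_two_bits i j a b :
  U [set omega | (dbit omega i == a) && (dbit omega j == b)] =
  (lim_mass (two_bits i j a b))%:E.
Proof.
rewrite two_bits_cyl -decode_law; congr (U _); apply/seteqP.
by split=> omega; rewrite /mkset decodeE !nth_mkseq// ltnS ?leq_maxl ?leq_maxr.
Qed.

Lemma Omega_measurable : measurable (Omega d gamma : set (config (site d) R)).
Proof. exact: (box_measurable (I := site d) 0 h). Qed.

Lemma mass_le_on_Omega L A B : measurable A -> measurable B ->
  A `&` Omega d gamma `<=` B -> mass L A <= mass L B.
Proof.
move=> mA mB AB; have mO := Omega_measurable.
have mOC := measurableC mO.
have O0 : m_ext gamma L (~` Omega d gamma) = 0%E.
  by rewrite probability_setC// [X in (1 - X)%E](mass_Omega gamma0) subee.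
rewrite -lee_fin !massE//; apply: (@le_trans _ _ (m_ext gamma L (B `|` ~` Omega d gamma))).
  apply: le_measure; rewrite ?inE//; first exact: measurableU.
  move=> eta Aeta; have [Oeta|] := pselect (Omega d gamma eta); last by right.
  by left; apply: AB.
apply: (le_trans (measureU2 _ mB mOC)).
by rewrite [X in (_ + X)%E]O0 adde0.
Qed.

Lemma lim_mass_two_bits0 i j a b :
  (forall eta, Omega d gamma eta -> ~ two_bits i j a b eta) ->
  lim_mass (two_bits i j a b) = 0.
Proof.
move=> H; rewrite two_bits_cyl; apply/eqP; rewrite eq_le lim_mass_ge0 andbT.
apply: (@lim_mass_le _ _ fset0) => L _.
rewrite -[leRHS](_ : mass L set0 = 0); last by rewrite /mass measure0.
apply: mass_le_on_Omega => //; first exact: cyl_measurable.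
by rewrite -two_bits_cyl => eta [? /H].
Qed.

(** The height at x is recovered as the supremum of the levels it reaches; 0
    and the cut at h only serve to make this supremum exist. *)
Definition reached (beta : nat -> bool) x : set R :=
  [set r | r = 0 \/ exists t : rat,
    [/\ r = ratr t, ratr t < h & beta (choice.pickle (x, t))]].

Definition decode_config (omega : measurableTypeR R) : config (site d) R :=
  fun x => sup (reached (dbit omega) x).
Local Notation Phi := decode_config.

Lemma reached_has_sup beta x : has_sup (reached beta x).
Proof.
split; first by exists 0; left.
by exists h => r [->|[t [-> /ltW]]] //; exact/ltW/hmax_gt0.
Qed.

Lemma decode_config_ge omega x r : reached (dbit omega) x r -> r <= Phi omega x.
Proof. by move=> rr; apply: (sup_upper_bound (reached_has_sup _ _)). Qed.

Lemma decode_config_ge0 omega x : 0 <= Phi omega x.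
Proof. by apply: decode_config_ge; left. Qed.

Lemma decode_config_gt omega x (s : rat) : (0 <= s)%R -> ratr s < Phi omega x ->
  exists t : rat, [/\ (s < t)%R, ratr t < h & dbit omega (choice.pickle (x, t))].
Proof.
move=> s0 /sup_gt[|r [->|[t [-> th bt]]]]; first by exists 0; left.
  by rewrite ltNge ler0q s0.
by rewrite ltr_rat => st; exists t.
Qed.

Lemma decode_config_measurable : measurable_fun setT Phi.
Proof.
apply: config_coord_measurable => x t.
have [t0|t0] := leP t 0.
  rewrite (_ : [set _ | _] = setT) //; apply/seteqP; split=> // omega _ /=.
  by rewrite (le_trans _ (decode_config_ge0 _ _))// lerq0.
pose F (s t' : rat) : set (measurableTypeR R) :=
  if (s < t')%R && (ratr t' < h) then [set omega | dbit omega (choice.pickle (x, t'))] else set0.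
pose G (s : rat) : set (measurableTypeR R) :=
  if (0 <= s)%R && (s < t)%R then \bigcup_t' F s t' else setT.
rewrite (_ : [set _ | _] = \bigcap_s G s).
  apply: countable_bigcap_measurable => s; rewrite /G; case: ifP => // _.
  apply: countable_bigcupT_measurable => // t'; rewrite /F; case: ifP => // _.
  exact: decode_bit_measurable.
apply/seteqP; split=> [omega /= tP s _|omega Gom /=].
  rewrite /G; case: ifP => // /andP[s0 st].
  have /(decode_config_gt s0)[t' [st' t'h bt']] : ratr s < Phi omega x.
    by rewrite (lt_le_trans _ tP)// ltr_rat.
  by exists t' => //; rewrite /F st' t'h.
rewrite leNgt; apply/negP => Plt.
have [s] : exists s : rat, ratr s \in `](Phi omega x), (ratr t)[ by exact: rat_in_itvoo.
rewrite in_itv /= => /andP[Ps st].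
have s0 : (0 <= s)%R by rewrite -(ler0q R) (le_trans (decode_config_ge0 _ _) (ltW Ps)).
have := Gom s Logic.I; rewrite /G s0 -(ltr_rat R) st /= => -[t' _].
rewrite /F; case: ifP => // /andP[st' t'h] /= bt'.
have : ratr t' <= Phi omega x by apply: decode_config_ge; right; exists t'.
by rewrite leNgt (lt_trans Ps)// ltr_rat.
Qed.

Lemma decode_config_preimage_measurable A : measurable A -> measurable (Phi @^-1` A).
Proof. by move=> mA; rewrite -[X in measurable X]setTI; exact: decode_config_measurable. Qed.

(** The numbers two of whose decoded bits take values that occur jointly with
    limiting mass 0. *)
Definition null_part : set (measurableTypeR R) :=
  \bigcup_(q : nat * nat * bool * bool)
    (if lim_mass (two_bits q.1.1.1 q.1.1.2 q.1.2 q.2) == 0 then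
       [set omega | (dbit omega q.1.1.1 == q.1.2) && (dbit omega q.1.1.2 == q.2)]
     else set0).

Lemma null_part_negligible : U.-negligible null_part.
Proof.
apply: negligible_countable_bigcup => -[[[i j] a] b] /=.
case: ifP => [/eqP H|_]; last exact: negligible_set0.
apply/negligibleP; last exact: etrans (decode_two_bits i j a b) (congr1 EFin H).
have mset k c : measurable [set omega : measurableTypeR R | dbit omega k == c].
  case: c.
    rewrite (_ : [set _ | _] = [set omega | dbit omega k]); first exact: decode_bit_measurable.
    by apply/seteqP; split=> omega /=; rewrite eqb_id.
  rewrite (_ : [set _ | _] = ~` [set omega | dbit omega k]).
    by apply: measurableC; exact: decode_bit_measurable.
  by apply/seteqP; split=> omega /=; rewrite eqbF_neg => /negP.
rewrite (_ : [set _ | _] = [set omega | dbit omega i == a] `&` [set omega | dbit omega j == b]).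
  exact: measurableI.
by apply/seteqP; split=> omega /= => [/andP|[-> ->]].
Qed.

Lemma notin_null_part omega i j a b : ~ null_part omega ->
  (forall eta, Omega d gamma eta -> ~ two_bits i j a b eta) ->
  dbit omega i = a -> dbit omega j = b -> False.
Proof.
move=> nN H ia jb; apply: nN; exists (i, j, a, b) => //=.
by rewrite lim_mass_two_bits0// eqxx /= ia jb !eqxx.
Qed.

Lemma decode_bit_mono omega i j : ~ null_part omega ->
  (threshold d i).1 = (threshold d j).1 -> ((threshold d i).2 <= (threshold d j).2)%R ->
  dbit omega j -> dbit omega i.
Proof.
move=> nN xij tij bj; apply/negPn/negP => /negbTE bi.
apply: (notin_null_part nN _ bj bi) => eta _ /andP[/eqP bj' /eqP].
by move: bj'; rewrite /bit xij => /(le_trans _) ->//; rewrite ler_rat.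
Qed.

Lemma decode_bit_low omega i : ~ null_part omega -> ((threshold d i).2 <= 0)%R ->
  dbit omega i.
Proof.
move=> nN t0; apply/negPn/negP => /negbTE bi.
apply: (notin_null_part nN _ bi bi) => eta st /andP[/eqP + _].
rewrite /bit (le_trans _ (proj1 (andP (st _))))//.
by rewrite lerq0.
Qed.

Lemma decode_bit_high omega i : ~ null_part omega -> h <= ratr (threshold d i).2 ->
  dbit omega i = false.
Proof.
move=> nN ht; apply/negP => bi.
apply: (notin_null_part nN _ bi bi) => eta st /andP[/eqP + _].
by rewrite /bit leNgt (lt_le_trans (proj2 (andP (st _))) ht).
Qed.

(** The bound [mass_strip_le] survives in the limit. *)
Lemma strip_law x (s t : rat) i : threshold d i = (x, t) ->
  (0 <= s)%R -> (s <= t)%R ->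
  lim_mass (two_bits (choice.pickle (x, s)) i true false) <= (ratr t - ratr s) / gamma.
Proof.
move=> it s0 st; rewrite two_bits_cyl.
apply: (@lim_mass_le _ _ [fset x]%fset) => L; rewrite fsub1set => xL.
apply: le_trans (mass_strip_le gamma0 xL s0 st).
rewrite -two_bits_cyl le_eqVlt; apply/orP; left; apply/eqP; congr (mass L _).
apply/seteqP; split=> eta; rewrite /two_bits /= /bit threshold_pickle it /=.
  by move=> /andP[/eqP -> /eqP/negbT]; rewrite -ltNge.
by move=> /andP[-> ]; rewrite ltNge => /negbTE ->.
Qed.

(** Off the null part the decoded bits are monotone in the level, so a bit can
    only differ from that of the decoded height when this height equals the
    level t while t was not reached. Every level s < t is then reached, which
    confines the number to a strip of probability at most (t - s) / gamma. *)
Lemma bit_decode_ae i : U.-negligible [set omega | dbit omega i != bit (Phi omega) i].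
Proof.
case E : (threshold d i) => [x t].
have disagree omega : ~ null_part omega -> dbit omega i != bit (Phi omega) i ->
    [/\ dbit omega i = false, (0 < t)%R &
    forall s : rat, (0 <= s)%R -> (s < t)%R -> dbit omega (choice.pickle (x, s))].
  move=> nN; rewrite /bit E /=; have [bi|/negbTE bi] := boolP (dbit omega i).
    have [ht|th] := leP h (ratr t).
      by move: bi; rewrite decode_bit_high// E.
    rewrite (_ : _ <= _)//; apply: decode_config_ge; right; exists t; split=> //.
    by apply: (decode_bit_mono nN) bi; rewrite threshold_pickle E.
  rewrite eq_sym eqbF_neg negbK => tP; split=> //.
    rewrite ltNge; apply/negP => t0.
    by move: bi; rewrite decode_bit_low// E.
  move=> s s0 st; have [|t' [st' _ bt']] := @decode_config_gt omega x s s0.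
    by rewrite (lt_le_trans _ tP)// ltr_rat.
  by apply: (decode_bit_mono nN) bt'; rewrite !threshold_pickle //= ltW.
have mdis : measurable [set omega | dbit omega i != bit (Phi omega) i].
  have mA := @decode_bit_measurable R word_mass i.
  have mB : measurable [set omega | bit (Phi omega) i].
    exact: (decode_config_preimage_measurable (bit_measurable i)).
  rewrite (_ : [set _ | _] = ([set omega | dbit omega i] `\` [set omega | bit (Phi omega) i])
     `|` ([set omega | bit (Phi omega) i] `\` [set omega | dbit omega i])).
    by apply: measurableU; [exact: measurableD mA mB|exact: measurableD mB mA].
  apply/seteqP; split=> omega /=.
    by case: (dbit omega i) (bit (Phi omega) i) => [] [] //= _; [left|right].
  by case: (dbit omega i) (bit (Phi omega) i) => [] [] //= [[]|[]].
apply/negligibleP => //.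
have [t0|t0] := leP t 0.
  apply/negligibleP => //; apply: negligibleS null_part_negligible => omega /= H.
  by apply: contrapT => nN; have [_] := disagree _ nN H; rewrite ltNge t0.
have bound (s : rat) : (0 <= s)%R -> (s < t)%R ->
   (U [set omega | dbit omega i != bit (Phi omega) i] <= ((ratr t - ratr s) / gamma)%:E)%E.
  move=> s0 st; have [N [mN N0 subN]] := null_part_negligible.
  pose S := [set omega | (dbit omega (choice.pickle (x, s)) == true) && (dbit omega i == false)].
  have mS : measurable S.
    rewrite (_ : S = [set omega | dbit omega (choice.pickle (x, s))] `\` [set omega | dbit omega i]).
      by apply: measurableD; exact: decode_bit_measurable.
    apply/seteqP; split=> omega; rewrite /S /= eqb_id eqbF_neg.
      by move=> /andP[bs /negP bi].
    by move=> [bs /negP bi]; apply/andP.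
  apply: (@le_trans _ _ (U (N `|` S))).
    apply: le_measure; rewrite ?inE//; first exact: measurableU.
    move=> omega /= H; have [/subN|nN] := pselect (null_part omega); first by left.
    have [b0 _ bs] := disagree _ nN H; right.
    by rewrite /S /= b0 bs.
  apply: (le_trans (measureU2 _ mN mS)); rewrite [X in (X + _)%E](_ : _ = 0%E) ?add0e//.
  rewrite [leLHS](_ : _ = (lim_mass (two_bits (choice.pickle (x, s)) i true false))%:E).
    by rewrite lee_fin; apply: strip_law => //; exact: ltW.
  exact: decode_two_bits.
apply/eqP; rewrite eq_le measure_ge0 andbT; apply/lee_addgt0Pr => e e0.
rewrite add0e.
have [s] : exists s : rat, ratr s \in `](Num.max 0 (ratr t - e * gamma)), (ratr t)[.
  apply: rat_in_itvoo; rewrite gt_max ltr0q t0 /=.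
  by rewrite ltrBlDr ltrDl mulr_gt0.
rewrite in_itv /= gt_max => /andP[/andP[s0 es] st].
apply: le_trans (bound s _ _) _; rewrite -?(ltr_rat R)// -?(ler0q R) ?(ltW s0)//.
by rewrite lee_fin ler_pdivrMr//; lra.
Qed.

Lemma word_decode_ae n : U.-negligible [set omega | dec n omega != word n (Phi omega)].
Proof.
have : U.-negligible (\bigcup_i [set omega | dbit omega i != bit (Phi omega) i]).
  by apply: negligible_bigcup => i; exact: bit_decode_ae.
apply: negligibleS => omega /= /eqP neq; apply: contrapT => H; apply: neq.
rewrite decodeE; apply/eq_in_map => i _; apply/eqP/negPn/negP => bi.
by apply: H; exists i.
Qed.

Definition limit_measure : set (config (site d) R) -> \bar R := pushforward U Phi.

Let limit_measure0 : limit_measure set0 = 0%E.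
Proof. by rewrite /limit_measure /pushforward preimage_set0 measure0. Qed.

Let limit_measure_ge0 A : (0 <= limit_measure A)%E.
Proof. by rewrite /limit_measure /pushforward measure_ge0. Qed.

Let limit_measure_sigma_additive : semi_sigma_additive limit_measure.
Proof.
pose m := measure_function_pushforward__canonical__measure_function_Measure
  U decode_config_measurable.
exact: (@measure_semi_sigma_additive _ _ _ m).
Qed.

HB.instance Definition _ := isMeasure.Build _ _ _ limit_measure
  limit_measure0 limit_measure_ge0 limit_measure_sigma_additive.

Let limit_measureT : limit_measure setT = 1%E.
Proof.
rewrite /limit_measure /pushforward preimage_setT /= /mrestr setTI.
rewrite [LHS](_ : _ = lebesgue_measure ([set` `[0, 1[ ] : set R))//.
by rewrite lebesgue_measure_itv /= lte_fin ltr01 sube0.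
Qed.

HB.instance Definition _ :=
  Measure_isProbability.Build _ _ _ limit_measure limit_measureT.

Definition limit_probability : probability (config (site d) R) R := limit_measure.

Lemma limit_measure_cyl n Q :
  limit_probability (cyl n Q) = (lim_mass (cyl n Q))%:E.
Proof.
rewrite -decode_law /= /limit_measure /pushforward.
have mA : measurable (Phi @^-1` cyl n Q).
  exact: (decode_config_preimage_measurable (cyl_measurable n Q)).
have mB : measurable [set omega | Q (dec n omega)].
  rewrite (_ : [set _ | _] = [set omega | Q (mkseq (dbit omega) n)]).
    exact: mkseq_measurable (@decode_bit_measurable _ _) _ _.
  by apply/seteqP; split=> omega; rewrite /= decodeE.
have [N [mN N0 subN]] := word_decode_ae n.
have le A B : measurable A -> measurable B -> A `\` N `<=` B -> (U A <= U B)%E.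
  move=> mA' mB' AB; apply: (@le_trans _ _ (U (N `|` B))).
    apply: le_measure; rewrite ?inE//; first exact: measurableU.
    move=> omega Ao; have [|] := pselect (N omega); first by left.
    by move=> nN; right; apply: AB.
  by apply: (le_trans (measureU2 _ mN mB')); rewrite [X in (X + _)%E](_ : _ = 0%E) ?add0e.
have same omega : ~ N omega -> dec n omega = word n (Phi omega).
  by move=> nN; apply/eqP/negPn/negP => H; apply: nN; exact: subN.
apply/eqP; rewrite eq_le; apply/andP; split; apply: le => // omega [].
  by rewrite /cyl /= => + /same ->.
by rewrite /cyl /= => + /same <-.
Qed.

Lemma limit_measure_cvg n Q :
  (fun L => mass L (cyl n Q)) @ totally --> fine (limit_probability (cyl n Q)).
Proof. by rewrite limit_measure_cyl; exact: lim_mass_cvg. Qed.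

End LimitMeasure.

(** * Support of the limit measure *)
Section Support.
Variables (R : realType) (d : nat) (gamma : R).
Hypothesis gamma0 : 0 < gamma.
Local Notation h := (hmax d gamma).
Local Notation mass := (mass gamma).

Local Notation m := (limit_probability d gamma0).

Lemma limit_cyl_le n Q (L0 : {fset site d}) (c : R) :
  (forall L, (L0 `<=` L)%fset -> mass L (cyl n Q) <= c) -> (m (cyl n Q) <= c%:E)%E.
Proof.
by move=> H; rewrite limit_measure_cyl lee_fin; exact: (lim_mass_le gamma0 H).
Qed.

Lemma probability_eq1 (A : set (config (site d) R)) :
  measurable A -> m.-negligible (~` A) -> m A = 1%E.
Proof.
move=> mA /negligibleP-/(_ (measurableC mA)) mA0.
have := probability_setC m (measurableC mA).
by rewrite setCK mA0 sube0.
Qed.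

(** Heights in all volumes are below h, so reaching s < h means falling in a
    strip [s, t) with t slightly above h. *)
Lemma limit_top_null x : m.-negligible [set eta | h <= eta x].
Proof.
have mA : measurable [set eta : config (site d) R | h <= eta x].
  rewrite (_ : [set _ | _] = ~` [set eta | eta x < h]).
    by apply: measurableC; exact: config_lt_measurable.
  by apply/seteqP; split=> eta /=; rewrite leNgt => /negP.
apply/negligibleP => //.
apply/eqP; rewrite eq_le measure_ge0 andbT; apply/lee_addgt0Pr => e e0.
rewrite add0e; have h0 := hmax_gt0 d gamma0.
have eg0 : 0 < e * gamma / 2 by rewrite !mulr_gt0// invr_gt0.
have [s] : exists s : rat, ratr s \in `](Num.max 0 (h - e * gamma / 2)), h[.
  by apply: rat_in_itvoo; rewrite gt_max h0 ltrBlDr ltrDl.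
have [t] : exists t : rat, ratr t \in `]h, (h + e * gamma / 2)[.
  by apply: rat_in_itvoo; rewrite ltrDl.
rewrite !in_itv /= gt_max => /andP[ht te] /andP[/andP[s0 se] sh].
pose i := choice.pickle (x, s).
apply: (@le_trans _ _ (m (cyl i.+1 (fun w => nth false w i)))).
  apply: le_measure; rewrite ?inE//; first exact: cyl_measurable.
  move=> eta /= hx; rewrite /cyl /= nth_word// /bit threshold_pickle /=.
  exact: le_trans (ltW sh) hx.
apply: (@limit_cyl_le _ _ [fset x]%fset) => L; rewrite fsub1set => xL.
have s0' : (0 <= s)%R by rewrite -(ler0q R) ltW.
have st' : (s <= t)%R by rewrite -(ler_rat R) ltW// (lt_trans sh).
apply: (@le_trans _ _ (mass L [set eta | ratr s <= eta x < ratr t])).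
  apply: (mass_le_on_Omega gamma0); first exact: cyl_measurable.
    rewrite (_ : [set _ | _] = [set eta : config (site d) R | eta x < ratr t] `\`
       [set eta | eta x < ratr s]).
      by apply: measurableD; exact: config_lt_measurable.
    apply/seteqP; split=> eta /=.
      by move=> /andP[a b]; split=> //; apply/negP; rewrite -leNgt.
    by move=> [-> /negP]; rewrite -leNgt => ->.
  move=> eta []; rewrite /cyl /= nth_word// /bit threshold_pickle /= => -> st.
  by have /andP[_ /lt_trans] := st x; apply.
apply: le_trans (mass_strip_le gamma0 xL s0' st') _.
by rewrite ler_pdivrMr//; lra.
Qed.

Lemma limit_nonneg x : m.-negligible [set eta | eta x < 0].
Proof.
apply/negligibleP; first exact: config_lt_measurable.
rewrite /= /limit_measure /pushforward (_ : _ @^-1` _ = set0) ?measure0//.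
by rewrite -subset0 => omega /=; rewrite ltNge decode_config_ge0.
Qed.

Lemma limit_Omega : m (Omega d gamma) = 1%E.
Proof.
apply: probability_eq1; first exact: Omega_measurable.
have : m.-negligible (\bigcup_x ([set eta | eta x < 0] `|` [set eta | h <= eta x])).
  apply: negligible_countable_bigcup => x.
  by apply: negligibleU; [exact: limit_nonneg|exact: limit_top_null].
apply: negligibleS => eta /= nO; apply: contrapT => H; apply: nO => x.
apply/andP; split.
  by rewrite leNgt; apply/negP => ?; apply: H; exists x => //; left.
by rewrite ltNge; apply/negP => ?; apply: H; exists x => //; right.
Qed.

(** Neighbour counts are rational levels, so this is a cylinder event. *)
Lemma limit_forbidden_null (W : {fset site d}) : W != fset0 ->
  m.-negligible [set eta | forall y, y \in W -> eta y < (nbrs_in R id W y)%:R].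
Proof.
move=> W0; pose i y := choice.pickle (y, (nbrs_in R id W y)%:R : rat).
pose n := (\max_(y <- W) i y).+1.
pose Q w := all (fun y => ~~ nth false w (i y)) W.
have E : [set eta | forall y, y \in W -> eta y < (nbrs_in R id W y)%:R] =
    cyl (R := R) n Q.
  have nthQ (eta : config (site d) R) y : y \in W ->
      ~~ nth false (word n eta) (i y) = (eta y < (nbrs_in R id W y)%:R).
    move=> yW; rewrite nth_word; last first.
      by rewrite ltnS; apply: (leq_bigmax_seq (F := i)).
    by rewrite /bit threshold_pickle /= ratr_nat -ltNge.
  apply/seteqP; split=> eta; rewrite /cyl /mkset /Q.
    by move=> H; apply/allP => y yW; rewrite nthQ// H.
  by move=> /allP H y yW; rewrite -nthQ//; exact: H.
apply/negligibleP; first by rewrite E; exact: cyl_measurable.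
apply/eqP; rewrite eq_le measure_ge0 andbT E.
apply: (@limit_cyl_le _ _ W) => L WL.
by rewrite -E (mass_forbidden gamma0 WL W0).
Qed.

Lemma limit_Rec : m (Rec d gamma) = 1%E.
Proof.
apply: probability_eq1; first exact: allowed_measurable.
have nO : m.-negligible (~` Omega d gamma).
  apply/negligibleP; first by apply: measurableC; exact: Omega_measurable.
  have := probability_setC m (@Omega_measurable R d gamma).
  by rewrite [X in (1 - X)%E]limit_Omega subee.
have nF : m.-negligible (\bigcup_(W : {fset site d}) (if W != fset0 then
    [set eta | forall y, y \in W -> eta y < (nbrs_in R id W y)%:R] else set0)).
  apply: negligible_countable_bigcup => W; case: ifP => [|_].
    exact: limit_forbidden_null.
  exact: negligible_set0.
apply: negligibleS (negligibleU nO nF) => eta /= nR.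
have [Oeta|] := pselect (Omega d gamma eta); last by left.
right; apply: contrapT => H; apply: nR; split=> // -[W [W0 forb]].
by apply: H; exists W => //; rewrite W0.
Qed.

End Support.

(** * Weak convergence *)

Section Exhaustion.
Variables (S : choiceType) (Lambda : nat -> {fset S}).

(** A finite set is covered by one volume, hence by all later ones. *)
Lemma exhaustion_cvg : exhaustion Lambda -> Lambda @ \oo --> totally.
Proof.
move=> [incr cover]; have mono k l : (k <= l)%N -> (Lambda k `<=` Lambda l)%fset.
  move=> /subnK <-; elim: (l - k)%N => [|j IH]; first exact: fsubset_refl.
  exact: fsubset_trans IH (incr _).
move=> P [A _ AP].
have [n0 Hn] : exists n0, forall x, x \in A -> x \in Lambda n0.
  have [n0 H] : exists n0, forall x, x \in enum_fset A -> x \in Lambda n0.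
    elim: (enum_fset A) => [|x s [n1 IH]]; first by exists 0%N.
    have [n2 xn2] := cover x; exists (maxn n1 n2) => y; rewrite inE.
    move=> /orP[/eqP ->|/IH]; first exact: (fsubsetP (mono _ _ (leq_maxr _ _))).
    exact: (fsubsetP (mono _ _ (leq_maxl _ _))).
  by exists n0.
exists n0 => // n /= n0n; apply: AP => /=; apply/fsubsetP => x /Hn.
exact/fsubsetP/mono.
Qed.

End Exhaustion.

Section WeakConvergence.
Variables (R : realType) (d : nat) (gamma : R).
Hypothesis gamma0 : 0 < gamma.
Local Notation Om := (Omega d gamma).
Implicit Types (mu : probability (config (site d) R) R) (k : seq bool -> R).

Let mOm : measurable (Om : set (config (site d) R)) := @Omega_measurable R d gamma.

Definition step_sum mu n k : R :=
  \sum_(w : n.-tuple bool) k w * fine (mu (cyl n (pred1 (w : seq bool)))).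

Lemma step_integral mu n k : mu Om = 1%E ->
  mu.-integrable Om (fun eta => (k (word n eta))%:E) /\
  (\int[mu]_(eta in Om) (k (word n eta))%:E = (step_sum mu n k)%:E)%E.
Proof.
move=> muO; pose C (w : n.-tuple bool) := cyl (R := R) (d := d) n (pred1 (w : seq bool)).
have mC w : measurable (C w) by exact: cyl_measurable.
have kE eta : (k (word n eta))%:E = (\sum_(w : n.-tuple bool) (k w)%:E * (\1_(C w) eta)%:E)%E.
  have sw : size (word n eta) == n by rewrite size_word.
  rewrite (bigD1 (Tuple sw))//= indicE mem_set /C /cyl /= ?eqxx// mule1.
  rewrite big1 ?adde0// => w wE; rewrite indicE memNset ?mule0//= => /eqP E.
  by move/eqP: wE; apply; apply: val_inj.
have i1 w : mu.-integrable Om (fun eta => (\1_(C w) eta)%:E).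
  by apply: integrableS (integrable_indic mu (mC w)).
have iC (w : n.-tuple bool) :
    mu.-integrable Om (fun eta => (k w)%:E * (\1_(C w) eta)%:E)%E.
  exact: integrableZl.
have -> : (fun eta => (k (word n eta))%:E) =
    (fun eta => \sum_(w : n.-tuple bool) (k w)%:E * (\1_(C w) eta)%:E)%E.
  by apply/funext.
split; first exact: integrable_sum.
rewrite integral_sum// /step_sum -sumEFin; apply: eq_bigr => w _.
have mCO : measurable (C w `&` Om) by exact: measurableI.
rewrite integralZl// integral_indic// EFinM fineK ?fin_num_measure//; last exact: mC.
congr (_ * _)%E; apply/eqP; rewrite -/(C w) eq_le; apply/andP; split.
  by apply: le_measure; rewrite ?inE//; (exact: subIsetl || exact: cyl_measurable).
have mOC := measurableC mOm.
have muOC : mu (~` Om) = 0%E by rewrite probability_setC// muO subee.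
apply: (@le_trans _ _ (mu ((C w `&` Om) `|` ~` Om))).
  apply: le_measure; rewrite ?inE//; first exact: measurableU.
  by move=> eta Ceta; have [?|?] := pselect (Om eta); [left|right].
apply: (le_trans (measureU2 _ mCO mOC)).
by rewrite [X in (_ + X)%E]muOC adde0.
Qed.

Variable (f : config (site d) R -> R).
Hypothesis cf : {within Om, continuous f}.

Lemma continuous_word eta eps : Om eta -> 0 < eps ->
  exists n, forall eta', Om eta' -> word n eta' = word n eta ->
    `|f eta - f eta'| <= eps.
Proof.
move=> Oeta eps0; have /subspace_continuousP cf' := cf.
have /cvgrPdist_le/(_ _ eps0) := cf' _ Oeta.
rewrite /within /= => /nbhs_word[n Hn].
by exists n => eta' O' wE; exact: Hn.
Qed.

(** By continuity the preimage of an open interval is, inside the domain, a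
    countable union of cylinders. *)
Lemma continuous_on_measurable : measurable_fun Om f.
Proof.
apply: (measurability _ (measurable_realfun.RGenOpens.measurableE R)).
move=> _ [_ [a [b ->] <-]].
rewrite (_ : Om `&` _ = Om `&` \bigcup_(nw : nat * seq bool)
   (if `[< cyl (R := R) nw.1 (pred1 nw.2) `&` Om `<=` f @^-1` `]a, b[ >] then
      cyl (R := R) nw.1 (pred1 nw.2) else set0)).
  apply: measurableI => //; apply: countable_bigcupT_measurable => // nw.
  by case: ifP => // _; exact: cyl_measurable.
apply/seteqP; split=> eta [Oeta].
  rewrite /= in_itv /= => /andP[ae eb]; split=> //.
  pose eps := Num.min (f eta - a) (b - f eta) / 2.
  have m0 : 0 < Num.min (f eta - a) (b - f eta) by rewrite lt_min !subr_gt0 ae.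
  have [n Hn] := continuous_word Oeta (divr_gt0 m0 (ltr0n _ 2)).
  exists (n, word n eta) => //; rewrite ifT; first by rewrite /cyl /=.
  apply/asboolP => eta' [/eqP wE O'] /=; rewrite in_itv /=.
  have := Hn _ O' wE; rewrite ler_norml => /andP[].
  have : Num.min (f eta - a) (b - f eta) <= f eta - a by rewrite ge_min lexx.
  have : Num.min (f eta - a) (b - f eta) <= b - f eta by rewrite ge_min lexx orbT.
  by move=> *; apply/andP; split; lra.
move=> [[n w] _] /=; case: ifP => // /asboolP sub Ceta; split=> //.
exact: sub.
Qed.

Variable (M : R).
Hypothesis fM : forall eta, Om eta -> `|f eta| <= M.

Definition tame (eps : R) n (w : seq bool) (c : R) :=
  forall eta, Om eta -> word n eta = w -> `|f eta - c| <= eps.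

Definition good eps n w : bool := `[< exists c, tame eps n w c >].

Definition center eps n w : R := if pselect (exists c, tame eps n w c) is left H
  then projT1 (cid H) else 0.

(** A bound for the distance from f to its approximation on the cell of w:
    on cells where f oscillates too much the approximation is 0, and M bounds
    f. *)
Definition slack eps n w : R := if good eps n w then eps else M.

Lemma center_slack eps n eta : Om eta ->
  `|f eta - center eps n (word n eta)| <= slack eps n (word n eta).
Proof.
move=> Oeta; rewrite /center /slack /good; case: pselect => [H|H].
  by rewrite asboolT//; case: (cid H) => c /= tc; exact: tc.
by rewrite asboolF// subr0 fM.
Qed.

(** Each configuration of the domain ends up in a good cell by continuity, and
    cells remain good when they are refined. *)
Lemma bad_cvg0 mu eps : mu Om = 1%E -> 0 < eps ->
  mu (cyl n (fun w => ~~ good eps n w)) @[n --> \oo] --> 0%E.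
Proof.
move=> muO eps0; pose B n := cyl (R := R) (d := d) n (fun w => ~~ good eps n w).
have mB n : measurable (B n) by exact: cyl_measurable.
have capB : mu (\bigcap_n B n) = 0%E.
  have mOC := measurableC mOm.
  have muOC : mu (~` Om) = 0%E by rewrite probability_setC// muO subee.
  apply/eqP; rewrite eq_le measure_ge0 andbT -muOC.
  apply: le_measure; rewrite ?inE//; first exact: bigcap_measurable.
  move=> eta Beta Oeta; have [n Hn] := continuous_word Oeta eps0.
  have /negP := Beta n Logic.I; apply; apply/asboolP; exists (f eta) => eta' O' wE.
  by rewrite distrC; exact: Hn.
rewrite -capB; apply: nonincreasing_cvg_mu => //.
- exact: (le_lt_trans (probability_le1 mu (mB 0%N)) (ltry 1)).
- exact: bigcapT_measurable.
move=> n k nk; apply/subsetPset => eta; rewrite /B /cyl /=; apply: contra => /asboolP[c tc].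
apply/asboolP; exists c => eta' O' wE; apply: tc => //.
have := congr1 (take n) wE; rewrite /word /mkseq -!map_take take_iota.
by rewrite (minn_idPl nk).
Qed.

Lemma integral_sandwich mu eps n : mu Om = 1%E ->
  ((step_sum mu n (fun w => center eps n w - slack eps n w))%:E <=
    \int[mu]_(eta in Om) (f eta)%:E <=
  (step_sum mu n (fun w => center eps n w + slack eps n w))%:E)%E.
Proof.
move=> muO; have [i1 <-] := step_integral n (fun w => center eps n w - slack eps n w) muO.
have [i2 <-] := step_integral n (fun w => center eps n w + slack eps n w) muO.
have fi : mu.-integrable Om (EFin \o f).
  apply: measurable_bounded_integrable => //.
  - exact: (le_lt_trans (probability_le1 mu mOm) (ltry 1)).
  - exact: continuous_on_measurable.
  - exists M; split; first exact: num_real.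
    by move=> x Mx eta Oeta; exact: le_trans (fM Oeta) (ltW Mx).
apply/andP; split; apply: le_integral => // eta; rewrite inE => Oeta; rewrite lee_fin.
  by have := center_slack eps n Oeta; rewrite ler_norml => /andP[? ?]; lra.
by have := center_slack eps n Oeta; rewrite ler_norml => /andP[? ?]; lra.
Qed.

Lemma step_sumB mu n k k' :
  step_sum mu n (fun w => k w - k' w) = step_sum mu n k - step_sum mu n k'.
Proof. by rewrite /step_sum -sumrB; apply: eq_bigr => w _; rewrite mulrBl. Qed.

Lemma step_sumD mu n k k' :
  step_sum mu n (fun w => k w + k' w) = step_sum mu n k + step_sum mu n k'.
Proof. by rewrite /step_sum -big_split; apply: eq_bigr => w _; rewrite mulrDl. Qed.

Lemma step_slack_le mu eps n : 0 <= eps ->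
  step_sum mu n (slack eps n) <=
  eps + M * fine (mu (cyl n (fun w => ~~ good eps n w))).
Proof.
move=> eps0; rewrite /step_sum (bigID (fun w : n.-tuple bool => good eps n w)) /= lerD//.
  rewrite (eq_bigr (fun w : n.-tuple bool => eps *
      fine (mu (cyl n (pred1 (w : seq bool)))))); last first.
    by move=> w gw; rewrite /slack gw.
  rewrite -big_distrr /= -(cyl_sum mu n (good eps n)) -[leRHS]mulr1 ler_wpM2l//.
  rewrite -lee_fin fineK ?fin_num_measure//; last exact: cyl_measurable.
  by apply: probability_le1; exact: cyl_measurable.
rewrite (eq_bigr (fun w : n.-tuple bool => M *
    fine (mu (cyl n (pred1 (w : seq bool)))))); last first.
  by move=> w /negbTE gw; rewrite /slack gw.
by rewrite -big_distrr /= -(cyl_sum mu n (fun w => ~~ good eps n w)).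
Qed.

Lemma integral_fin mu : mu Om = 1%E ->
  (\int[mu]_(eta in Om) (f eta)%:E)%E \is a fin_num.
Proof.
move=> muO; have /andP[lo hi] := integral_sandwich 1 0 muO.
by rewrite fin_real// (lt_le_trans (ltNyr _) lo) (le_lt_trans hi (ltry _)).
Qed.

(** In the limit measure the upper and the lower step functions have integrals
    at most delta / 2 apart, and their integrals in finite volumes converge, as
    cylinder masses do; the integrals of f are squeezed in between. *)
Lemma weak_limit (Lambda : nat -> {fset site d}) : exhaustion Lambda ->
  (fun j => \int[m_ext gamma (Lambda j)]_(eta in Om) (f eta)%:E)%E @ \oo -->
  (\int[limit_probability d gamma0]_(eta in Om) (f eta)%:E)%E.
Proof.
move=> exh; pose mu (j : nat) : probability (config (site d) R) R := m_ext gamma (Lambda j).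
pose m := limit_probability d gamma0.
have muO j : mu j Om = 1%E by exact: mass_Omega.
have mO : m Om = 1%E by exact: limit_Omega.
have stepc n c : step_sum (mu j) n c @[j --> \oo] --> step_sum m n c.
  apply: cvg_big => [|w _]; first exact: add_continuous.
  apply: cvgMr; pose C := cyl (R := R) (d := d) n (pred1 (w : seq bool)).
  have : (fun L => mass gamma L C) \o Lambda @ \oo --> fine (m C).
    by apply: cvg_comp; [exact: exhaustion_cvg|exact: limit_measure_cvg].
  exact.
rewrite -[X in _ --> X](fineK (integral_fin mO)); apply/fine_cvgP; split.
  by apply: nearW => j; exact: (integral_fin (muO j)).
apply/cvgrPdist_le => delta delta0.
(* The gap between the step functions is twice the slack, itself at most eps
   plus the contribution of the bad cells, which is made at most eps. *)
pose eps := delta / 8; have eps0 : 0 < eps by rewrite divr_gt0.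
have [n Mn] : exists n, M * fine (m (cyl n (fun w => ~~ good eps n w))) <= eps.
  have /fine_cvgP[_ bad0] := bad_cvg0 mO eps0.
  have : M * fine (m (cyl n (fun w => ~~ good eps n w))) @[n --> \oo] --> M * 0.
    exact: cvgMr.
  rewrite mulr0 => /cvgr0_norm_le /(_ _ eps0)[n _ /(_ n (leqnn n))] /= H.
  by exists n; apply: le_trans H; exact: ler_norm.
pose lo w := center eps n w - slack eps n w.
pose hi w := center eps n w + slack eps n w.
have gap : step_sum m n hi - step_sum m n lo <= delta / 2.
  rewrite step_sumD step_sumB; have := step_slack_le m n (ltW eps0).
  by rewrite /eps in Mn *; lra.
have delta4 : 0 < delta / 4 by rewrite divr_gt0.
have /cvgrPdist_le/(_ _ delta4) near_lo := stepc n lo.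
have /cvgrPdist_le/(_ _ delta4) near_hi := stepc n hi.
near=> j.
have : `|step_sum m n lo - step_sum (mu j) n lo| <= delta / 4 by near: j.
have : `|step_sum m n hi - step_sum (mu j) n hi| <= delta / 4 by near: j.
have bounds (nu : probability (config (site d) R) R) : nu Om = 1%E ->
    step_sum nu n lo <= fine (\int[nu]_(eta in Om) (f eta)%:E)%E <= step_sum nu n hi.
  move=> nuO; have := integral_sandwich eps n nuO.
  by rewrite -{1 2}(fineK (integral_fin nuO)) !lee_fin.
have /andP[a1 a2] := bounds _ mO; have /andP[b1 b2] := bounds _ (muO j).
rewrite !ler_norml => /andP[h1 h2] /andP[l1 l2]; apply/andP.
by move: gap a1 a2 b1 b2 h1 h2 l1 l2; rewrite /=; split; lra.
Unshelve. all: by end_near. Qed.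

End WeakConvergence.

Theorem theorem4p1 (R : realType) (d : nat) (hd : (0 < d)%N)
    (gamma : R) (hgamma : 0 < gamma) :
  exists m : probability (config (site d) R) R,
    [/\ m (Omega d gamma) = 1%E,
        forall Lambda : nat -> {fset site d}, exhaustion Lambda ->
          weak_cvg_on (Omega d gamma) (fun n => m_ext gamma (Lambda n)) m
      & m (Rec d gamma) = 1%E].
Proof.
exists (limit_probability d hgamma); split.
- exact: limit_Omega.
- move=> Lambda exh f cf [M [_ fM]].
  have fM1 eta : Omega d gamma eta -> `|f eta| <= M + 1.
    by move=> Oeta; apply: fM Oeta; rewrite ltrDl.
  exact: (weak_limit (gamma0 := hgamma) cf fM1 exh).
- exact: limit_Rec.
Qed.
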